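(* Let $m\ge 2$ be an integer, $n>0$, and let $\Omega\subset\mathbb{R}^N$ be a bounded domain with smooth boundary such that $\lambda_1(\Omega)<1$, where $\lambda_1(\Omega)$ is the first eigenvalue of $(-\Delta)^m$ in $\Omega$ with Dirichlet boundary conditions. Let $v_0$ be sufficiently smooth bounded initial data with $E(v_0)>0$, where $E(v)=-\int_\Omega|\tilde D^m v|^2\,dx+\int_\Omega v^2\,dx$. Then the solution $v(x,t)$ of the initial-boundary value problem $$(\psi(v))_t=(-1)^{m+1}\Delta^m v+v\ \text{ in }\Omega\times\mathbb{R}_+,\qquad v=Dv=\dots=D^{m-1}v=0\ \text{ on }\partial\Omega\times\mathbb{R}_+,\qquad v(x,0)=v_0(x)\ \text{ in }\Omega,$$ with $\psi(v)=|v|^{-\frac{n}{n+1}}v$, is not uniformly bounded for $t>0$ (i.e. it is not the case that $v$ exists for all $t>0$ with $\sup_{t>0}\sup_{x\in\Omega}|v(x,t)|<\infty$).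
   Context: Notation: $\tilde D^m=\Delta^{m/2}$ for even $m$ and $\tilde D^m=\nabla\Delta^{(m-1)/2}$ for odd $m$. $\lambda_1(\Omega)>0$ is the smallest eigenvalue of $(-\Delta)^m e=\lambda e$ in $\Omega$ with $e=De=\dots=D^{m-1}e=0$ on $\partial\Omega$; equivalently $\lambda_1$ is the best constant in $\lambda_1\int_\Omega v^2\,dx\le\int_\Omega|\tilde D^m v|^2\,dx$ for $v\in H^m_0(\Omega)$. The function $\psi$ is set to be $0$ at $v=0$. The equation arises from $u_t=(-1)^{m+1}\Delta^m(|u|^nu)+|u|^nu$ through $v=|u|^nu$, $v_0=|u_0|^nu_0$. Solutions are understood to be sufficiently smooth: one may multiply the equation by $v$ and by $v_t$, and integrate by parts over $\Omega$ using the boundary conditions. *)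

(* Defs.v *)
From HB Require Import structures.
From mathcomp Require Import all_boot all_order all_algebra.
From mathcomp Require Import all_classical all_reals all_analysis.

Set Implicit Arguments.
Unset Strict Implicit.
Unset Printing Implicit Defensive.

Import Order.TTheory GRing.Theory Num.Theory.
Import numFieldNormedType.Exports.

Local Open Scope classical_set_scope.
Local Open Scope ring_scope.

Section tuple_cons_measure.
Context {R : realType} {n : nat}.
Variable mu : {sigma_finite_measure set (n.-tuple (measurableTypeR R)) -> \bar R}.

Definition tcons (p : measurableTypeR R * n.-tuple (measurableTypeR R)) :
  n.+1.-tuple (measurableTypeR R) := [tuple of p.1 :: p.2].

Lemma measurable_tcons : measurable_fun [set: _] tcons.
Proof. exact: measurable_cons. Qed.

Definition tcons_measure : set (n.+1.-tuple (measurableTypeR R)) -> \bar R :=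
  pushforward (lebesgue_measure \x mu)%E tcons.

Let tcons_measure0 : tcons_measure set0 = 0%E.
Proof. by rewrite /tcons_measure /pushforward preimage_set0 measure0. Qed.

Let tcons_measure_ge0 A : (0 <= tcons_measure A)%E.
Proof. by rewrite /tcons_measure /pushforward. Qed.

Let tcons_measure_sigma_additive : semi_sigma_additive tcons_measure.
Proof.
move=> F mF tF mUF; rewrite /tcons_measure /pushforward preimage_bigcup.
have mpre A : measurable A -> measurable (tcons @^-1` A).
  by move=> mA; rewrite -[X in measurable X]setTI; exact: measurable_tcons.
apply: measure_semi_sigma_additive.
- by move=> k; exact: (mpre _ (mF k)).
- apply/trivIsetP => /= i j _ _ ij; rewrite -preimage_setI.
  by move/trivIsetP : tF => /(_ _ _ _ _ ij) ->//; rewrite preimage_set0.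
- by rewrite -preimage_bigcup; exact: (mpre _ mUF).
Qed.

HB.instance Definition _ := isMeasure.Build _ _ _ tcons_measure
  tcons_measure0 tcons_measure_ge0 tcons_measure_sigma_additive.

Let tcons_measure_sigma_finite : sigma_finite setT tcons_measure.
Proof.
have /sigma_finiteP[F [TF ndF Foo]] := sigma_finiteT (@lebesgue_measure R).
have /sigma_finiteP[G [TG ndG Goo]] := sigma_finiteT mu.
pose g (t : n.+1.-tuple (measurableTypeR R)) := (thead t, [tuple of behead t]).
have mg : measurable_fun setT g.
  apply/measurable_fun_pairP; split; last exact: measurable_behead.
  exact: (measurable_tnth ord0).
have tK : cancel tcons g.
  by move=> [x t]; congr (_, _); apply/val_inj.
exists (fun k => g @^-1` (F k `*` G k)).
  rewrite -preimage_bigcup; apply/esym; rewrite -subTset => t _ /=.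
  have [i _ Fi] : (\bigcup_k F k) (g t).1 by rewrite -TF.
  have [j _ Gj] : (\bigcup_k G k) (g t).2 by rewrite -TG.
  exists (maxn i j) => //; split.
    by move: Fi; exact/subsetPset/ndF/leq_maxl.
  by move: Gj; exact/subsetPset/ndG/leq_maxr.
move=> k; have [mF Fk] := Foo k; have [mG Gk] := Goo k; split.
  by rewrite -[X in measurable X]setTI; apply: mg => //; exact: measurableX.
rewrite [ltLHS](_ : _ = (lebesgue_measure \x mu)%E (F k `*` G k)).
  by rewrite product_measure1E// lte_mul_pinfty// ge0_fin_numE.
rewrite /tcons_measure /pushforward; congr ((_ \x _)%E _).
by apply/seteqP; split => x; rewrite /preimage /mkset tK.
Qed.

HB.instance Definition _ := Measure_isSigmaFinite.Build _ _ _
  tcons_measure tcons_measure_sigma_finite.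

End tuple_cons_measure.

Fixpoint lebesgueN (R : realType) (N : nat) :
    {sigma_finite_measure set (N.-tuple (measurableTypeR R)) -> \bar R} :=
  match N with
  | 0 => \d_([tuple])
  | N'.+1 => tcons_measure (lebesgueN R N')
  end.

Lemma lebesgueN_box (R : realType) (N : nat) (a b : 'I_N -> R) :
  (forall i, a i <= b i) ->
  lebesgueN R N [set t | forall i, a i <= tnth t i <= b i]
  = (\prod_i (b i - a i))%:E.
Proof.
elim: N a b => [|N IH] a b ab.
  by rewrite big_ord0 /= diracE mem_set//= => -[].
rewrite big_ord_recl EFinM -(IH (a \o lift ord0) (b \o lift ord0)); last first.
  by move=> i; exact: ab.
have -> : (b ord0 - a ord0)%:E = lebesgue_measure `[a ord0, b ord0]%classic.
  rewrite lebesgue_measure_itv/= lte_fin; have := ab ord0.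
  by rewrite le_eqVlt => /predU1P[->|->]; rewrite ?ltxx ?subrr// EFinB.
have mbox n (c d : 'I_n -> R) :
    measurable [set t : n.-tuple (measurableTypeR R) |
                forall i, c i <= tnth t i <= d i].
  rewrite (_ : [set t | _] = \bigcap_(i in setT)
      ((@tnth n (measurableTypeR R))^~ i @^-1` `[c i, d i]%classic)).
    apply: fin_bigcap_measurable => // i _.
    by rewrite -[X in measurable X]setTI; apply: measurable_tnth.
  by apply/seteqP; split => t /= h i; have := h i; rewrite /= in_itv//=; apply.
rewrite -product_measure1E//=; last exact: mbox.
rewrite /tcons_measure /pushforward; congr ((_ \x _)%E _).
apply/seteqP; split => -[x t] /=.
  move=> h; split; first by have := h ord0; rewrite in_itv.
  by move=> i; have := h (lift ord0 i); rewrite tnthS.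
move=> [h1 h2] i; case: (unliftP ord0 i) => [j ->|->].
  by rewrite tnthS; exact: h2.
by move: h1; rewrite in_itv.
Qed.

Definition row_of (R : realType) (N : nat)
  (t : N.-tuple (measurableTypeR R)) : 'rV[R]_N := \row_i (tnth t i : R).

Definition integralN (R : realType) (N : nat) (Omega : set 'rV[R]_N)
    (f : 'rV[R]_N -> R) : R :=
  \int[lebesgueN R N]_(t in @row_of R N @^-1` Omega) f (row_of t).

Section pde.
Context {R : realType} {N : nat}.
Implicit Types (Omega : set 'rV[R]_N) (f : 'rV[R]_N -> R) (s : seq 'I_N).

Definition evec (i : 'I_N) : 'rV[R]_N := delta_mx 0 i.

(* The partial derivative of order [size s]; multi-indices are represented by
   words in the coordinates, so the entries of the tensor D^k f are the
   [pderiv s f] with [size s = k]. *)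
Definition pderiv s f : 'rV[R]_N -> R := foldr (fun i g => 'D_(evec i) g) f s.

Definition laplacian f : 'rV[R]_N -> R :=
  fun x => \sum_(i < N) pderiv [:: i; i] f x.

Definition polylaplacian (m : nat) f : 'rV[R]_N -> R := iter m laplacian f.

Definition sqr_norm_Dtilde (m : nat) f : 'rV[R]_N -> R := fun x =>
  if odd m then \sum_(i < N) ('D_(evec i) (polylaplacian m./2 f) x) ^+ 2
  else (polylaplacian m./2 f x) ^+ 2.

Definition energy (m : nat) Omega f : R :=
  - integralN Omega (sqr_norm_Dtilde m f) + integralN Omega (fun x => f x ^+ 2).

Definition smooth_on (U : set 'rV[R]_N) f :=
  forall s x, U x ->
    {for x, continuous (pderiv s f)} /\
    forall i, derivable (pderiv s f) x (evec i).

(* Near each boundary point, Omega is the sublevel set {rho < 0} of a smooth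
   function without critical point there. *)
Definition smooth_boundary Omega :=
  forall p, (closure Omega `\` Omega) p ->
    exists (U : set 'rV[R]_N) (rho : 'rV[R]_N -> R),
      [/\ open U, U p, smooth_on U rho,
          exists i, 'D_(evec i) rho p != 0 &
          Omega `&` U = [set x | U x /\ rho x < 0]].

Definition smooth_bounded_domain Omega :=
  [/\ Omega !=set0, open Omega, connected Omega, bounded_set Omega &
      smooth_boundary Omega].

(* The class C^{k,0}(closure Omega x I): f has spatial derivatives up to order k
   on Omega x I, which extend continuously to closure Omega x I. *)
Definition Ck_closure_time (k : nat) Omega (I : set R)
    (f : R -> 'rV[R]_N -> R) :=
  (forall s i t x, (size s < k)%N -> I t -> Omega x ->
     derivable (pderiv s (f t)) x (evec i)) /\
  (forall s, (size s <= k)%N -> exists g : R * 'rV[R]_N -> R,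
     {within I `*` closure Omega, continuous g} /\
     forall t x, I t -> Omega x -> g (t, x) = pderiv s (f t) x).

Definition Ck_closure (k : nat) Omega f :=
  (forall s i x, (size s < k)%N -> Omega x ->
     derivable (pderiv s f) x (evec i)) /\
  (forall s, (size s <= k)%N -> exists g : 'rV[R]_N -> R,
     {within closure Omega, continuous g} /\
     forall x, Omega x -> g x = pderiv s f x).

(* f = Df = ... = D^{m-1}f = 0 on the boundary, in the sense of boundary limits
   from inside Omega. *)
Definition dirichlet_bc (m : nat) Omega f :=
  forall s p, (size s < m)%N -> (closure Omega `\` Omega) p ->
    pderiv s f x @[x --> within Omega (nbhs p)] --> (0 : R).

Definition dirichlet_eigenvalue (m : nat) Omega (lam : R) :=
  exists e : 'rV[R]_N -> R,
    [/\ exists2 x, Omega x & e x != 0,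
        Ck_closure m.*2 Omega e,
        forall x, Omega x -> (-1) ^+ m * polylaplacian m e x = lam * e x &
        dirichlet_bc m Omega e].

Definition first_dirichlet_eigenvalue (m : nat) Omega (lam : R) :=
  dirichlet_eigenvalue m Omega lam /\
  forall mu, dirichlet_eigenvalue m Omega mu -> lam <= mu.

(* The value at s = 0 is 0, whatever the convention for 0 `^ _. *)
Definition psi (n s : R) : R := `|s| `^ (- (n / (n + 1))) * s.

(* Classical solution on Omega x (0, T), with T = +oo allowed. Only psi(v) is
   required to be differentiable in time; v = |u|^n u with u = psi(v) then is
   too. The initial data is attained together with its derivatives up to
   order m, which are those entering the energy. *)
Definition classical_solution (m : nat) (n : R) Omega f (T : \bar R)
    (v : R -> 'rV[R]_N -> R) :=
  [/\ Ck_closure_time m.*2 Omega [set t | 0 < t /\ (t%:E < T)%E] v,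
      Ck_closure_time m Omega [set t | 0 <= t /\ (t%:E < T)%E] v,
      forall t x, 0 < t -> (t%:E < T)%E -> Omega x ->
        is_derive t 1 (fun tau => psi n (v tau x))
          ((-1) ^+ m.+1 * polylaplacian m (v t) x + v t x),
      forall t, 0 < t -> (t%:E < T)%E -> dirichlet_bc m Omega (v t) &
      forall x, Omega x -> v 0 x = f x].

Definition uniformly_bounded Omega (v : R -> 'rV[R]_N -> R) :=
  exists M : R, forall t x, 0 < t -> Omega x -> `|v t x| <= M.

End pde.

(* Main.v *)
(* Write u = psi(v), so that v = |u|^n u and u_t = F with
   F = (-1)^(m+1) Laplacian^m v + v. Green's formula and the Dirichlet
   conditions give E(v(t)) = \int v(t) F(t), and the bilinear form
   (v(s), v(t)) |-> \int v(s) F(t) is symmetric. Hence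
   E(v(t)) - E(v(s)) = \int (v(t) - v(s)) (F(t) + F(s)), which is nonnegative up to
   o(t - s) because v is an increasing function of u: the energy is nondecreasing,
   and E(v(t)) >= E(v_0) > 0 for all t. On the other hand \int |u|^(n+2) has
   derivative (n+2) E(v(t)), so it grows at least linearly, which is
   incompatible with a uniform bound on v. Working with increments rather than with
   d/dt E avoids assuming that v_t has spatial derivatives.

   Integration by parts against a function vanishing on the boundary needs no
   regularity of the boundary: extended by zero, the function is Lipschitz along
   every coordinate direction, and translation invariance of the Lebesgue measure
   shows that the integral of its difference quotients is o(1). *)

Require Import Defs.
From mathcomp Require Import all_boot all_order all_algebra.
From mathcomp Require Import all_classical all_reals all_analysis.
From mathcomp Require Import measurable_realfun zify ring lra.
Import Order.TTheory GRing.Theory Num.Theory.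
Import numFieldNormedType.Exports.
Local Open Scope classical_set_scope.
Local Open Scope ring_scope.

Set Implicit Arguments.
Unset Strict Implicit.
Unset Printing Implicit Defensive.

Local Notation integralN := Defs.integralN.

(** * Measurability of open sets and of continuous functions, read on tuples *)

Section row_of_measurability.
Context {R : realType} {N : nat}.

(** The norm on rows is the sup norm, so an open set is the countable union of the cubes with
    rational centre and radius 1/(k+1) that it contains, and each cube is a finite intersection of
    coordinate conditions. *)
Lemma measurable_row_of_preimage (U : set 'rV[R]_N) :
  open U -> measurable (@row_of R N @^-1` U).
Proof.
move=> oU.
pose box (q : 'rV[rat]_N) (k : nat) :=
  [set x : 'rV[R]_N | forall j, `|ratr (q 0 j) - x 0 j| < k.+1%:R^-1].
pose F (i : 'rV[rat]_N * nat) :=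
  [set t | box i.1 i.2 `<=` U /\ box i.1 i.2 (@row_of R N t)].
have -> : @row_of R N @^-1` U = \bigcup_i F i.
  apply/seteqP; split=> [t /= Ut|t [i _ [sub /sub]]//].
  have /nbhs_ballP[e /= e0 eU] : nbhs (row_of t) U by exact: open_nbhs_nbhs.
  (* The radius is taken below [e / 2] because points of a cube are compared with [row_of t] through
     the rational centre. *)
  have [k _ ke] := near_infty_natSinv_lt (PosNum (divr_gt0 e0 (ltr0Sn R 1))).
  have {}ke := ke k (leqnn k); rewrite /= in ke.
  have k0 : 0 < k.+1%:R^-1 :> R by rewrite invr_gt0.
  have ex j : exists q : rat, `|ratr q - tnth t j| < k.+1%:R^-1.
    have := @rat_in_itvoo R (tnth t j - k.+1%:R^-1) (tnth t j + k.+1%:R^-1).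
    case; first by rewrite ltrBlDr -addrA ltrDl addr_gt0.
    by move=> q; rewrite in_itv/= => qj; exists q; rewrite ltr_distl.
  exists (\row_j (sval (cid (ex j))), k) => //; split=> /=.
    move=> x bx; apply: eU.
    rewrite -[ball]/(@ball _ 'rV[R]_N) mx_norm_ball /ball_ /=.
    rewrite [ltLHS]/Num.Def.normr/= mx_normrE.
    apply/bigmax_ltP; split => // -[i j] _ /=; rewrite ord1 !mxE.
    have := bx j; rewrite mxE; case: cid => q /= q1 q2.
    rewrite distrC in q1; have := ler_distD (ratr q) (tnth t j) (x 0 j).
    by move=> /le_lt_trans; apply; rewrite (splitr e) ltrD// (lt_trans _ ke).
  by move=> j; rewrite !mxE; case: cid.
apply: countable_bigcupT_measurable => [|[q k]]; first exact: countableP.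
rewrite /F/=; have [sub|nsub] := pselect (box q k `<=` U); last first.
  by rewrite (_ : mkset _ = set0)// -subset0 => t [].
rewrite (_ : mkset _ = \bigcap_(j in [set: 'I_N])
   ((@tnth N (measurableTypeR R))^~ j @^-1` (ball (ratr (q 0 j) : R) k.+1%:R^-1))).
  apply: fin_bigcap_measurable => // i _.
  rewrite -[X in measurable X]setTI; apply: measurable_tnth => //.
  exact: measurable_ball.
apply/seteqP; split=> [t [_ tb] j _|t tb]; first by have := tb j; rewrite mxE.
by split => // j; rewrite mxE; exact: tb.
Qed.

Lemma measurable_fun_row_of (Omega : set 'rV[R]_N) (f : 'rV[R]_N -> R) :
  open Omega -> (forall x, Omega x -> {for x, continuous f}) ->
  measurable_fun (@row_of R N @^-1` Omega) (f \o @row_of R N).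
Proof.
move=> oO cf; apply: (measurability _ (RGenOpens.measurableE R)) => //.
move=> _ [_ [a [b ->]] <-].
rewrite (_ : _ `&` _ = @row_of R N @^-1` (Omega `&` f @^-1` `]a, b[)); last first.
  by apply/seteqP; split => t [].
apply: measurable_row_of_preimage; rewrite openE => x [Ox fx].
apply: filterI; first exact: open_nbhs_nbhs.
by apply: (cf x Ox); apply: open_nbhs_nbhs.
Qed.

End row_of_measurability.

(** * Translation invariance of the Lebesgue measure on R^N *)

Section translation.
Context {R : realType}.

Let rshift (a x : measurableTypeR R) : measurableTypeR R := x + a.

Let measurable_rshift a : measurable_fun setT (rshift a).
Proof. exact: measurable_funD. Qed.

Lemma lebesgue_measure_translation (a : R) (A : set (measurableTypeR R)) :
  measurable A ->
  lebesgue_measure ((fun x => x + a) @^-1` A) = lebesgue_measure A :> \bar R.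
Proof.
move=> mA; apply/esym.
rewrite (@lebesgue_measure_unique R
  (pushforward (@lebesgue_measure R) (rshift a)))// => X [[b c] _ <-].
rewrite /pushforward.
rewrite [X in lebesgue_measure X = _](_ : _ = `]b, c]%classic)//.
rewrite [RHS](_ : _ = lebesgue_measure `]b - a, c - a]%classic); last first.
  congr (lebesgue_measure _); apply/seteqP; split => x;
  by rewrite /preimage/= !in_itv/= /rshift ltrBlDr lerBrDr.
rewrite !lebesgue_measure_itv/= !lte_fin ltrD2r.
by case: ifP => // _; congr EFin; rewrite /=; ring.
Qed.

Definition tuple_shift N (a : 'I_N -> R) (t : N.-tuple (measurableTypeR R)) :
  N.-tuple (measurableTypeR R) := [tuple (tnth t j + a j : measurableTypeR R) | j < N].

Lemma row_of_tuple_shift N (a : 'I_N -> R) t :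
  row_of (tuple_shift a t) = row_of t + \row_j a j.
Proof. by apply/rowP => j; rewrite !mxE tnth_mktuple. Qed.

Lemma tuple_shiftK N (a : 'I_N -> R) :
  cancel (tuple_shift a) (tuple_shift (fun j => - a j)).
Proof. by move=> t; apply: eq_from_tnth => j; rewrite !tnth_mktuple addrK. Qed.

Lemma measurable_tuple_shift N (a : 'I_N -> R) :
  measurable_fun setT (tuple_shift a).
Proof.
apply/measurable_fun_tnthP => j.
rewrite (_ : _ \o _ = fun t => rshift (a j) (tnth t j)); last first.
  by apply/funext => t /=; rewrite tnth_mktuple.
exact: (measurableT_comp (@measurable_rshift (a j)) (measurable_tnth j)).
Qed.

(** By induction on the dimension: a translation acts factorwise, so the pushforward of the product
    measure agrees with it on rectangles, and uniqueness of the product measure applies. *)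
Lemma lebesgueN_translation N (a : 'I_N -> R) A : measurable A ->
  lebesgueN R N (tuple_shift a @^-1` A) = lebesgueN R N A.
Proof.
elim: N a A => [|N IH] a A mA.
  rewrite (_ : _ @^-1` A = A)//.
  have ta t : tuple_shift a t = t by apply: eq_from_tnth => -[].
  by apply/seteqP; split => t; rewrite /preimage/= ta.
pose b : 'I_N -> R := a \o lift ord0.
pose S (p : measurableTypeR R * N.-tuple (measurableTypeR R)) :=
  (rshift (a ord0) p.1, tuple_shift b p.2).
have mS : measurable_fun setT S.
  apply/measurable_fun_pairP; split.
    exact: (measurableT_comp (@measurable_rshift (a ord0)) measurable_fst).
  exact: (measurableT_comp (@measurable_tuple_shift _ b) measurable_snd).
have mtA : measurable (@tcons R N @^-1` A).
  by rewrite -[X in measurable X]setTI; exact: measurable_tcons.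
have SE p : tuple_shift a (tcons p) = tcons (S p).
  case: p => x t; apply: eq_from_tnth => j.
  by have [k ->|->] := unliftP ord0 j; rewrite tnth_mktuple ?tnthS ?tnth_mktuple.
rewrite /= /tcons_measure /pushforward.
rewrite [RHS](product_measure_unique
  (m' := pushforward (lebesgue_measure \x lebesgueN R N)%E S))//.
  rewrite /pushforward; congr ((_ \x _)%E _); apply/seteqP.
  by split => p; rewrite /preimage/= SE.
move=> B C mB mC; rewrite /pushforward.
transitivity ((lebesgue_measure \x lebesgueN R N)%E
    ((rshift (a ord0) @^-1` B) `*` (tuple_shift b @^-1` C))); first by [].
have mB' : measurable (rshift (a ord0) @^-1` B).
  by rewrite -[X in measurable X]setTI; exact: measurable_rshift.
have mC' : measurable (tuple_shift b @^-1` C).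
  by rewrite -[X in measurable X]setTI; exact: measurable_tuple_shift.
rewrite product_measure1E// IH//; congr (_ * _)%E.
exact: lebesgue_measure_translation.
Qed.

End translation.

(** * One-variable Lipschitz bounds for functions vanishing off an open set *)

Section vanishing_lipschitz.
Context {R : realType}.

(** The first point [inf S] outside [O] at or after [a] is a zero of [phi], and the segment before
    it lies in [O], where the mean value theorem applies. *)
Let lipschitz_to_zero (O : set R) (phi dphi : R -> R) (C a c : R) :
  open O -> continuous phi -> (forall s, ~ O s -> phi s = 0) ->
  (forall s, O s -> is_derive s 1 phi (dphi s)) ->
  (forall s, O s -> `|dphi s| <= C) ->
  0 <= C -> a <= c -> ~ O c -> `|phi a| <= C * (c - a).
Proof.
move=> oO cphi phi0 dphiE dphiC C0 ac Oc.
pose S := [set s | a <= s /\ ~ O s].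
have Sc : S c by [].
have lbS : lbound S a by move=> s [].
have iS : has_inf S by split; [exists c|exists a].
have ad : a <= inf S by apply: lb_le_inf => //; exists c.
have dc : inf S <= c by apply: ge_inf => //; exists a.
(* If [inf S] were in [O], an interval to its right would be too, and [inf S + e] would be a larger
   lower bound of [S]. *)
have nd : ~ O (inf S).
  move=> Od; have /nbhs_ballP[e /= e0 eO] : nbhs (inf S) O by exact: open_nbhs_nbhs.
  suff : inf S + e <= inf S by rewrite gerDl leNgt e0.
  apply: lb_le_inf; first by exists c.
  move=> s Ss; rewrite leNgt; apply/negP => se; apply: Ss.2; apply: eO.
  have ds : inf S <= s by apply: ge_inf => //; exists a.
  by rewrite /ball/= distrC ger0_norm ?subr_ge0// ltrBlDl.
apply: (@le_trans _ _ (C * (inf S - a))); last by rewrite ler_wpM2l// lerB.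
move: ad; rewrite le_eqVlt => /predU1P[->|ad].
  by rewrite phi0// normr0 subrr mulr0.
have Oin s : s \in `]a, inf S[%R -> O s.
  rewrite in_itv/= => /andP[as_ sd]; apply: contrapT => Os.
  have : inf S <= s by apply: ge_inf; [exists a|split => //; exact: ltW].
  by rewrite leNgt sd.
have [s sin E] := MVT ad (fun s h => dphiE s (Oin s h)) (continuous_subspaceT cphi).
rewrite -normrN -[X in `|X|]add0r -(phi0 _ nd) E normrM.
rewrite [X in _ * X]ger0_norm ?subr_ge0 ?(ltW ad)//.
by rewrite ler_wpM2r ?subr_ge0 ?(ltW ad)// dphiC//; exact: Oin.
Qed.

(** If the segment stays in [O], this is the mean value theorem. Otherwise both end values are
    compared with the value 0 at a point [c] outside [O], and the two bounds add up to
    [C * (b - a)]. *)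
Lemma lipschitz_vanishing_outside (O : set R) (phi dphi : R -> R) (C a b : R) :
  open O -> continuous phi -> (forall s, ~ O s -> phi s = 0) ->
  (forall s, O s -> is_derive s 1 phi (dphi s)) ->
  (forall s, O s -> `|dphi s| <= C) ->
  0 <= C -> a <= b -> `|phi b - phi a| <= C * (b - a).
Proof.
move=> oO cphi phi0 dphiE dphiC C0; rewrite le_eqVlt => /predU1P[->|ab].
  by rewrite !subrr normr0 mulr0.
have [[c [/andP[ac cb] Oc]]|] := pselect (exists c, a <= c <= b /\ ~ O c).
  have ha := lipschitz_to_zero oO cphi phi0 dphiE dphiC C0 ac Oc.
  (* The bound at [b] is [lipschitz_to_zero] for the reflected function s |-> phi(-s). *)
  have hb : `|(phi \o -%R) (- b)| <= C * (- c - - b).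
    apply: (@lipschitz_to_zero (-%R @^-1` O) _ (fun s => dphi (- s) * -1)) => //.
    - by apply: open_comp => // x _; exact: opp_continuous.
    - by move=> x; apply: continuous_comp; [exact: opp_continuous|exact: cphi].
    - by move=> s; exact: phi0.
    - move=> s Os; apply: (@is_derive1_comp _ phi -%R); exact: dphiE.
    - by move=> s Os; rewrite normrM normrN1 mulr1; exact: dphiC.
    - by rewrite lerN2.
    - by rewrite /= opprK.
  rewrite /= opprK in hb.
  apply: (le_trans (ler_normB _ _)); apply: (le_trans (lerD hb ha)).
  by rewrite -mulrDr [X in C * X <= _](_ : _ = b - a)//; ring.
move=> nO; have Oin s : s \in `]a, b[%R -> O s.
  rewrite in_itv/= => /andP[as_ sb]; apply: contrapT => Os.
  by apply: nO; exists s; rewrite (ltW as_) (ltW sb).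
have [s sin E] := MVT ab (fun s h => dphiE s (Oin s h)) (continuous_subspaceT cphi).
rewrite E normrM [X in _ * X]ger0_norm ?subr_ge0 ?(ltW ab)//.
by rewrite ler_wpM2r ?subr_ge0 ?(ltW ab)// dphiC//; exact: Oin.
Qed.

End vanishing_lipschitz.

(** * Integration of bounded continuous functions over a bounded open set *)

Section bounded_continuous.
Context {R : realType} {N : nat} (Omega : set 'rV[R]_N).
Hypotheses (oO : open Omega) (bO : bounded_set Omega).
Implicit Types f g : 'rV[R]_N -> R.

(** A class of integrands stable under sums and products, for which integrability over a bounded
    open set is automatic. *)
Definition bounded_continuous f :=
  (forall x, Omega x -> {for x, continuous f}) /\
  exists C, forall x, Omega x -> `|f x| <= C.

Local Notation dom := (@row_of R N @^-1` Omega).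
Local Notation mu := (lebesgueN R N).

Lemma measurable_dom : measurable dom.
Proof. exact: measurable_row_of_preimage. Qed.

Lemma lebesgueN_bounded_lty : (mu dom < +oo)%E.
Proof.
have [M [_ /(_ (M + 1))]] := bO; rewrite ltrDl ltr01 => /(_ isT) OM.
pose K := `|M + 1|.
pose B := [set t : N.-tuple (measurableTypeR R) | forall i : 'I_N, - K <= tnth t i <= K].
have BE : mu B = (\prod_(i < N) (K - - K))%:E.
  apply: (@lebesgueN_box R N (fun=> - K) (fun=> K)) => i.
  by apply: (@le_trans _ _ 0); rewrite ?oppr_le0 normr_ge0.
apply: (@le_lt_trans _ _ (mu B)); last by rewrite BE ltry.
apply: le_measure.
- by rewrite inE; exact: measurable_dom.
- rewrite inE (_ : B = \bigcap_(i in setT)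
      ((@tnth N (measurableTypeR R))^~ i @^-1` `[- K, K]%classic)).
    apply: fin_bigcap_measurable => // i _.
    by rewrite -[X in measurable X]setTI; apply: measurable_tnth.
  by apply/seteqP; split => t /= h i; have := h i; rewrite /= in_itv//=; apply.
move=> t Ot i; rewrite -ler_norml.
have := OM _ Ot => tM; apply: (le_trans _ (le_trans tM (ler_norm _))).
rewrite [leRHS]/Num.Def.normr/= mx_normrE.
by apply/bigmax_geP; right; exists (ord0, i) => //=; rewrite mxE.
Qed.

Lemma bounded_continuous_integrable f : bounded_continuous f ->
  mu.-integrable dom (EFin \o (f \o @row_of R N)).
Proof.
move=> [cf [C fC]]; apply: measurable_bounded_integrable.
- exact: measurable_dom.
- exact: lebesgueN_bounded_lty.
- exact: measurable_fun_row_of.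
- exists `|C|; split => // x Cx t Ot /=; apply: (le_trans (fC _ Ot)).
  by rewrite (le_trans (ler_norm _))// ltW.
Qed.

Lemma bounded_continuousD f g : bounded_continuous f -> bounded_continuous g ->
  bounded_continuous (fun x => f x + g x).
Proof.
move=> [cf [C fC]] [cg [D gD]]; split.
  by move=> x Ox; apply: continuousD; [exact: cf|exact: cg].
by exists (C + D) => x Ox; rewrite (le_trans (ler_normD _ _))// lerD ?fC ?gD.
Qed.

Lemma bounded_continuousM f g : bounded_continuous f -> bounded_continuous g ->
  bounded_continuous (fun x => f x * g x).
Proof.
move=> [cf [C fC]] [cg [D gD]]; split.
  by move=> x Ox; apply: continuousM; [exact: cf|exact: cg].
by exists (C * D) => x Ox; rewrite normrM ler_pM ?fC ?gD.
Qed.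

Lemma bounded_continuous_cst c : bounded_continuous (fun=> c).
Proof. by split; [move=> x _; exact: cst_continuous|exists `|c|]. Qed.

Lemma bounded_continuousZ c f : bounded_continuous f ->
  bounded_continuous (fun x => c * f x).
Proof. by move=> bf; apply: bounded_continuousM => //; exact: bounded_continuous_cst. Qed.

Lemma bounded_continuousB f g : bounded_continuous f -> bounded_continuous g ->
  bounded_continuous (fun x => f x - g x).
Proof.
move=> bf bg; have /(bounded_continuousD bf) := bounded_continuousZ (-1) bg.
by congr bounded_continuous; apply/funext => x; rewrite mulN1r.
Qed.

Lemma bounded_continuous_sum (I : finType) (F : I -> 'rV[R]_N -> R) :
  (forall i, bounded_continuous (F i)) ->
  bounded_continuous (fun x => \sum_i F i x).
Proof.
move=> bF; suff h (s : seq I) : bounded_continuous (fun x => \sum_(i <- s) F i x) by exact: h.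
elim: s => [|i s IH].
  by under eq_fun do rewrite big_nil; exact: bounded_continuous_cst.
by under eq_fun do rewrite big_cons; exact: bounded_continuousD.
Qed.

Lemma integralN_D f g : bounded_continuous f -> bounded_continuous g ->
  integralN Omega (fun x => f x + g x) = integralN Omega f + integralN Omega g.
Proof.
move=> bf bg; rewrite /integralN (RintegralD measurable_dom)//;
exact: bounded_continuous_integrable.
Qed.

Lemma integralN_B f g : bounded_continuous f -> bounded_continuous g ->
  integralN Omega (fun x => f x - g x) = integralN Omega f - integralN Omega g.
Proof.
move=> bf bg; rewrite /integralN (RintegralB measurable_dom)//;
exact: bounded_continuous_integrable.
Qed.

Lemma integralN_Z c f : bounded_continuous f ->
  integralN Omega (fun x => c * f x) = c * integralN Omega f.
Proof.
move=> bf; rewrite /integralN (RintegralZl c measurable_dom)//;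
exact: bounded_continuous_integrable.
Qed.

Lemma integralN_sum (I : finType) (F : I -> 'rV[R]_N -> R) :
  (forall i, bounded_continuous (F i)) ->
  integralN Omega (fun x => \sum_i F i x) = \sum_i integralN Omega (F i).
Proof.
move=> bF; suff h (s : seq I) : bounded_continuous (fun x => \sum_(i <- s) F i x) /\
    integralN Omega (fun x => \sum_(i <- s) F i x) = \sum_(i <- s) integralN Omega (F i).
  exact: (h _).2.
elim: s => [|i s [IH1 IH2]].
  under eq_fun do rewrite big_nil; rewrite big_nil; split.
    exact: bounded_continuous_cst.
  by rewrite /integralN (Rintegral_cst mu measurable_dom) mul0r.
under eq_fun do rewrite big_cons; split; first exact: bounded_continuousD.
by rewrite integralN_D// IH2 big_cons.
Qed.

Lemma integralN_cst c : integralN Omega (fun=> c) = c * fine (mu dom).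
Proof. by rewrite /integralN (Rintegral_cst mu measurable_dom). Qed.

Lemma le_integralN f g : bounded_continuous f -> bounded_continuous g ->
  (forall x, Omega x -> f x <= g x) -> integralN Omega f <= integralN Omega g.
Proof.
move=> bf bg fg; rewrite /integralN.
apply: (le_Rintegral measurable_dom); try exact: bounded_continuous_integrable.
by move=> t Ot; exact: fg.
Qed.

Lemma eq_integralN f g : (forall x, Omega x -> f x = g x) ->
  integralN Omega f = integralN Omega g.
Proof. by move=> fg; apply: eq_Rintegral => t /set_mem Ot; exact: fg. Qed.

End bounded_continuous.

(** * A partial derivative of a function vanishing at the boundary has integral zero *)

Section mean_zero_derivative.
Context {R : realType} {N : nat} (Omega : set 'rV[R]_N).
Hypotheses (oO : open Omega) (bO : bounded_set Omega).
Variables (h : 'rV[R]_N -> R) (i : 'I_N).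
Hypothesis dh : forall x, Omega x -> derivable h x (evec i).
Hypothesis bh : bounded_continuous Omega h.
Hypothesis bdh : bounded_continuous Omega ('D_(evec i) h).
Hypothesis h0 : forall p, (closure Omega `\` Omega) p ->
  h x @[x --> within Omega (nbhs p)] --> (0 : R).

Let H : 'rV[R]_N -> R := h \_ Omega.
Let e : 'rV[R]_N := evec i.

Let HE x : Omega x -> H x = h x.
Proof. by move=> Ox; rewrite /H /restrict mem_set. Qed.

Let H0 x : ~ Omega x -> H x = 0.
Proof. by move=> Ox; rewrite /H /restrict memNset. Qed.

Let H_near x : Omega x -> \forall y \near x, h y = H y.
Proof.
move=> Ox; near=> y; rewrite HE//; near: y; exact: open_nbhs_nbhs.
Unshelve. all: by end_near. Qed.

(** At a boundary point the limit is given by [h0]; away from [closure Omega] the extension is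
    locally zero. *)
Let continuous_zero_extension : continuous H.
Proof.
suff cH (p : 'rV[R]_N) : H x @[x --> p] --> H p by move=> p; exact: cH.
have FF : Filter (nbhs p) := nbhs_filter p.
have [Op|nOp] := pselect (Omega p).
  rewrite HE//; exact: (cvg_trans (near_eq_cvg (H_near Op)) (bh.1 p Op)).
rewrite [H p]H0//.
have [cp|ncp] := pselect (closure Omega p); last first.
  have : nbhs p (~` closure Omega).
    by apply: open_nbhs_nbhs; split => //; exact/closed_openC/closed_closure.
  move=> np; have nH : \forall x \near p, H x = 0.
    apply: (@filterS _ _ _ (~` closure Omega)) => // x ncx.
    by rewrite H0// => Ox; apply: ncx; exact: subset_closure.
  exact: cvg_near_cst.
apply/cvgrPdist_lt => eps eps0.
have := h0 (conj cp nOp); move/cvgrPdist_lt => /(_ _ eps0); rewrite near_withinE.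
apply: filterS => x hx; have [Ox|nOx] := pselect (Omega x).
  by rewrite HE//; exact: hx.
by rewrite H0// subrr normr0.
Qed.

Let line p s : 'rV[R]_N := s *: e + p.

Let continuous_line p : continuous (line p).
Proof.
move=> s; apply: cvgD; last exact: cvg_cst.
by apply: cvgZr_tmp; exact: cvg_id.
Qed.

Let is_derive_line p s : Omega (line p s) ->
  is_derive s 1 (fun s => H (line p s)) ('D_e h (line p s)).
Proof.
move=> Os; have dH : is_derive (line p s) e H ('D_e h (line p s)).
  apply: (near_eq_is_derive (H_near Os)); exact/derivableP/dh.
have E : (fun r : R => r^-1 *: (((fun s => H (line p s)) \o shift s) (r *: 1) - H (line p s)))
   = (fun r : R => r^-1 *: ((H \o shift (line p s)) (r *: e) - H (line p s))).
  apply/funext => r /=; congr (_ *: (H _ - _)); rewrite /line.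
  by rewrite [r *: 1]mulr1 scalerDl addrA.
split; first by rewrite /derivable E; exact: (@derive.ex_derive _ _ _ _ _ _ _ dH).
by rewrite /derive E; exact: (@derive.derive_val _ _ _ _ _ _ _ dH).
Qed.

(** [lipschitz_vanishing_outside] is applied on each line of direction [e]: the constant is a bound
    on the derivative inside [Omega], however the line meets [Omega]. *)
Let H_lipschitz : exists2 C, 0 <= C &
  forall p r, 0 <= r -> `|H (r *: e + p) - H p| <= C * r.
Proof.
have [C dC] := bdh.2; exists `|C| => // p r r0.
have := @lipschitz_vanishing_outside R (line p @^-1` Omega) (fun s => H (line p s))
  (fun s => 'D_e h (line p s)) `|C| 0 r.
rewrite /line scale0r add0r subr0; apply => //.
- by apply: open_comp => // x _; exact: continuous_line.
- move=> s; apply: (@continuous_comp _ _ _ (line p) H).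
    exact: continuous_line.
  exact: continuous_zero_extension.
- by move=> s; exact: H0.
- by move=> s Os; exact: is_derive_line.
- by move=> s Os; rewrite (le_trans (dC _ Os))// ler_norm.
Qed.

Local Notation dom := (@row_of R N @^-1` Omega).
Local Notation mu := (lebesgueN R N).

Let step k : R := k.+1%:R^-1.
Let dir r (j : 'I_N) : R := if j == i then r else 0.

Let row_of_shift r t : row_of (tuple_shift (dir r) t) = r *: e + row_of t.
Proof.
rewrite row_of_tuple_shift addrC; congr (_ + _); apply/rowP => j.
by rewrite !mxE eqxx /= /dir; case: eqP => _; rewrite ?mulr1 ?mulr0.
Qed.

(* Discarding the points whose translate by -r leaves Omega makes both G r and its
   translate by r vanish outside dom, hence have the same integral over dom. *)
Let G r t : R := H (row_of t) * \1_dom (tuple_shift (dir (- r)) t).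

Let tuple_shiftN r t : tuple_shift (dir (- r)) (tuple_shift (dir r) t) = t.
Proof.
rewrite -[RHS](tuple_shiftK (dir r)); congr tuple_shift; apply/funext => j.
by rewrite /dir; case: ifP; rewrite ?oppr0.
Qed.

Let mdom : measurable dom. Proof. exact: measurable_dom. Qed.

Let measurable_G r : measurable_fun setT (G r).
Proof.
apply: measurable_funM.
  rewrite (_ : (fun t => H (row_of t)) = (h \o @row_of R N) \_ dom); last first.
    apply/funext => t; have [Ot|nOt] := pselect (Omega (row_of t)).
      by rewrite HE// /restrict mem_set.
    by rewrite H0// /restrict memNset.
  apply/(measurable_restrictT _ mdom).
  by apply: measurable_fun_row_of => //; exact: bh.1.
have m1 : measurable_fun setT (\1_dom : N.-tuple (measurableTypeR R) -> R).
  exact: measurable_indic.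
exact: (measurableT_comp m1 (measurable_tuple_shift (dir (- r)))).
Qed.

Let G_bounded : exists C, forall r t, `|G r t| <= C.
Proof.
have [C hC] := bh.2; exists `|C| => r t; rewrite /G normrM.
rewrite -[leRHS]mulr1 ler_pM//; last by rewrite indicE; case: (_ \in _); rewrite ?normr1 ?normr0.
have [Ot|nOt] := pselect (Omega (row_of t)); last by rewrite H0// normr0.
by rewrite HE// (le_trans (hC _ Ot))// ler_norm.
Qed.

Let measurable_GS r : measurable_fun setT (G r \o tuple_shift (dir r)).
Proof. by apply: measurableT_comp; [exact: measurable_G|exact: measurable_tuple_shift]. Qed.

Let integrable_dom (f : N.-tuple (measurableTypeR R) -> R) :
  measurable_fun setT f -> (exists C, forall t, `|f t| <= C) ->
  mu.-integrable dom (EFin \o f).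
Proof.
move=> mf [C fC]; apply: measurable_bounded_integrable => //.
- exact: lebesgueN_bounded_lty.
- exact: measurable_funTS.
- exists `|C|; split => // x Cx t Ot /=; apply: (le_trans (fC t)).
  by rewrite (le_trans (ler_norm _))// ltW.
Qed.

Let integrable_G r : mu.-integrable dom (EFin \o G r).
Proof. by apply: integrable_dom => //; have [C GC] := G_bounded; exists C. Qed.

Let integrable_GS r : mu.-integrable dom (EFin \o (G r \o tuple_shift (dir r))).
Proof.
by apply: integrable_dom => //; have [C GC] := G_bounded; exists C => t; exact: GC.
Qed.

Let GE r : (EFin \o G r) = (EFin \o G r) \_ dom.
Proof.
apply/funext => t; rewrite /restrict; case: ifPn => // /negP; rewrite inE => nt.
by rewrite /= /G H0// mul0r.
Qed.

Let GSE r : (EFin \o (G r \o tuple_shift (dir r))) =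
  (EFin \o (G r \o tuple_shift (dir r))) \_ dom.
Proof.
apply/funext => t; rewrite /restrict; case: ifPn => // nt.
by rewrite /= /G tuple_shiftN indicE (negbTE nt) mulr0.
Qed.

(** Both integrands vanish outside [dom], so the integrals extend to the whole space, where
    translation invariance identifies them. *)
Let integral_GS r :
  \int[mu]_(t in dom) (G r (tuple_shift (dir r) t)) = \int[mu]_(t in dom) G r t.
Proof.
rewrite /Rintegral; congr fine.
rewrite integral_mkcond [RHS]integral_mkcond.
rewrite -[X in integral _ _ X]/((EFin \o (G r \o tuple_shift (dir r))) \_ dom).
rewrite -GSE -[X in _ = integral _ _ X]/((EFin \o G r) \_ dom) -GE.
have iS : mu.-integrable (tuple_shift (dir r) @^-1` setT)
    ((EFin \o G r) \o tuple_shift (dir r)).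
  rewrite preimage_setT; have /(integrable_mkcond _ mdom) := integrable_GS r.
  by rewrite -GSE.
have mG : measurable_fun setT (EFin \o G r) by exact/measurable_EFinP.
have := integral_pushforward (measurable_tuple_shift (dir r)) mG iS measurableT.
rewrite preimage_setT => <-.
apply: (eq_measure_integral mu); first exact: measurable_tuple_shift.
by move=> mS A mA _; exact: lebesgueN_translation.
Qed.

Let diff r t : R := G r (tuple_shift (dir r) t) - G r t.

Let measurable_diff r : measurable_fun setT (diff r).
Proof. by apply: measurable_funB; [exact: measurable_GS|exact: measurable_G]. Qed.

Let integrable_diff r : mu.-integrable dom (EFin \o diff r).
Proof.
apply: integrable_dom => //; have [C GC] := G_bounded; exists (C + C) => t.
by rewrite (le_trans (ler_normB _ _))// lerD.
Qed.

Let quot k t : R := (step k)^-1 * diff (step k) t.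

Let integral_quot k : (\int[mu]_(t in dom) (quot k t)%:E = 0)%E.
Proof.
under eq_integral do rewrite EFinM.
rewrite integralZl//; last exact: integrable_diff.
rewrite -[X in (_ * X)%E]fineK ?(integrable_fin_num mdom (integrable_diff _))//.
rewrite -[fine _]/(\int[mu]_(t in dom) diff (step k) t) RintegralB//.
  by rewrite integral_GS subrr mule0.
exact: integrable_GS.
Qed.

Let step_gt0 k : 0 < step k. Proof. by rewrite invr_gt0. Qed.

Let quot_bound : exists C, forall k t, dom t -> `|quot k t| <= C.
Proof.
have [C C0 HC] := H_lipschitz; exists (C + C) => k t Ot.
rewrite /quot /diff normrM ger0_norm ?invr_ge0 ?(ltW (step_gt0 k))//.
rewrite mulrC ler_pdivrMr// /G tuple_shiftN [\1_dom t]indicE mem_set// mulr1.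
rewrite indicE row_of_shift; have [|] := boolP (_ \in dom).
  by move=> _; rewrite mulr1 (le_trans (HC _ _ (ltW _)))// ler_wpM2r ?lerDl// ltW.
(* The backward translate is outside [Omega], so the cut-off removes the second term. Since [H]
   vanishes at that translate, what remains is a sum of two consecutive increments of [H], whence
   the bound [C + C]. *)
rewrite notin_setE /= row_of_shift => nO; rewrite mulr0 subr0.
have -> : H (step k *: e + row_of t) = (H (step k *: e + row_of t) - H (row_of t))
  + (H (step k *: e + (- step k *: e + row_of t)) - H (- step k *: e + row_of t)).
  by rewrite (H0 nO) subr0 addrA -scalerDl subrr scale0r add0r subrK.
by rewrite (le_trans (ler_normD _ _))// mulrDl lerD// HC// ltW.
Qed.

Let step_cvg0 : step k @[k --> \oo] --> (0 : R).
Proof. exact: cvg_harmonic. Qed.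

(** [Omega] being open, the backward translate stays in it for large [k]; the cut-off is then 1 and
    [quot] is the usual difference quotient. *)
Let quot_cvg t : dom t -> quot k t @[k --> \oo] --> 'D_e h (row_of t).
Proof.
move=> Ot; pose x := row_of t.
have dH : is_derive x e H ('D_e h x).
  apply: (near_eq_is_derive (H_near Ot)); exact/derivableP/dh.
pose q (r : R) : R := r^-1 *: (H (r *: e + x) - H x).
have qc : q r @[r --> 0^'] --> ('D_e h x : R).
  rewrite -(@derive.derive_val _ _ _ _ _ _ _ dH).
  exact: (@derive.ex_derive _ _ _ _ _ _ _ dH).
have /cvgr_dnbhsP/(_ step) qs := qc.
have {}qs : q (step k) @[k --> \oo] --> 'D_e h x.
  by apply: qs; split => // k; rewrite gt_eqF.
apply: cvg_trans qs; apply: near_eq_cvg.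
have nO : \forall k \near \oo, Omega (line x (- step k)).
  have s0 : - step k @[k --> \oo] --> (0 : R) by rewrite -oppr0; exact: cvgN.
  have := cvg_comp _ _ s0 (@continuous_line x 0); rewrite /line scale0r add0r.
  by apply; exact: open_nbhs_nbhs.
apply: filterS nO => k Ok.
rewrite /q /quot /diff /G tuple_shiftN row_of_shift !indicE mem_set// mulr1.
by rewrite mem_set ?mulr1// /= row_of_shift.
Qed.

(** Dominated convergence: the quotients [quot k] have integral zero, are uniformly bounded on [dom]
    and tend pointwise to the derivative. *)
Lemma integral_derive_zero : integralN Omega ('D_(evec i) h) = 0.
Proof.
have [C qC] := quot_bound.
have [] := @dominated_convergence _ _ R mu dom mdom (fun k t => (quot k t)%:E)
  (fun t => ('D_e h (row_of t))%:E) (cst C%:E).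
- move=> k; apply/measurable_EFinP; apply: measurable_funTS.
  exact: measurable_funM.
- apply/measurable_EFinP.
  exact: (measurable_fun_row_of oO bdh.1).
- apply: aeW => t Ot; apply: cvg_EFin; [exact: nearW|exact: quot_cvg].
- by apply: integrable_dom => //; exists `|C|.
- by apply: aeW => t k Ot; rewrite lee_fin qC.
move=> _ _ c; rewrite /Defs.integralN /Rintegral.
suff -> : (\int[mu]_(t in dom) ('D_e h (row_of t))%:E = 0)%E by [].
rewrite -(cvg_lim _ c)//; apply: cvg_lim => //; apply: cvg_near_cst.
by apply: nearW => k; exact: integral_quot.
Qed.

End mean_zero_derivative.

(** * Functions of time and space that extend continuously to the closure of the domain *)

Section closure_extendable.
Context {R : realType} {N : nat} (Omega : set 'rV[R]_N).
Hypotheses (oO : open Omega) (bO : bounded_set Omega).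
Implicit Types (I : set R) (F G : R -> 'rV[R]_N -> R).

(** The continuity clause of [Ck_closure_time] for a single function; compactness of the closed
    cylinder turns it into estimates uniform in [x]. *)
Definition closure_extendable I F := exists g : R * 'rV[R]_N -> R,
  {within I `*` closure Omega, continuous g} /\
  forall t x, I t -> Omega x -> g (t, x) = F t x.

Lemma closure_extendableW I J F : J `<=` I ->
  closure_extendable I F -> closure_extendable J F.
Proof.
move=> JI [g [cg gE]]; exists g; split=> [|t x Jt]; last by apply: gE; exact: JI.
by apply: continuous_subspaceW cg => -[t x] [/= /JI].
Qed.

(** Freezing the time turns a function of [x] alone into a family constant in time, so that the same
    lemmas serve both cases. *)
Lemma closure_extendable_slice I F t : I t -> closure_extendable I F ->
  closure_extendable setT (fun=> F t).
Proof.
move=> It [g [cg gE]]; exists (fun p => g (t, p.2)); split => [|s x _ Ox]; last exact: gE.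
apply/subspace_continuousP => -[s x] [/= _ cx].
have /subspace_continuousP/(_ (t, x) (conj It cx)) gc := cg.
apply: (cvg_comp _ _ _ gc) => A [[U V] /= [Ut Vx] UVA].
exists (setT, V); first by split => //; exact: filterT.
move=> [s' x'] /= [_ Vx'] [_ cx']; apply: (UVA (t, x')); last by split.
by split => //; exact: nbhs_singleton.
Qed.

Lemma closure_extendable_cst I c : closure_extendable I (fun _ _ => c).
Proof.
exists (cst c); split => //.
by apply: continuous_subspaceT => x; exact: cst_continuous.
Qed.

Lemma closure_extendableD I F G : closure_extendable I F -> closure_extendable I G ->
  closure_extendable I (fun t x => F t x + G t x).
Proof.
move=> [f [cf fE]] [g [cg gE]]; exists (fun p => f p + g p); split => [p|t x It Ox].
  by apply: continuousD; [exact: cf|exact: cg].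
by rewrite fE// gE.
Qed.

Lemma closure_extendableM I F G : closure_extendable I F -> closure_extendable I G ->
  closure_extendable I (fun t x => F t x * G t x).
Proof.
move=> [f [cf fE]] [g [cg gE]]; exists (fun p => f p * g p); split => [p|t x It Ox].
  by apply: continuousM; [exact: cf|exact: cg].
by rewrite fE// gE.
Qed.

Lemma closure_extendable_sum I n (F : 'I_n -> R -> 'rV[R]_N -> R) :
  (forall i, closure_extendable I (F i)) ->
  closure_extendable I (fun t x => \sum_i F i t x).
Proof.
move=> cF.
suff h (s : seq 'I_n) : closure_extendable I (fun t x => \sum_(i <- s) F i t x).
  exact: h.
elim: s => [|i s IH].
  by under eq_fun do under eq_fun do rewrite big_nil; exact: closure_extendable_cst.
by under eq_fun do under eq_fun do rewrite big_cons; exact: closure_extendableD.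
Qed.

Let compact_cylinder (a b : R) : compact (`[a, b]%classic `*` closure Omega).
Proof.
apply: compact_setX; first exact: segment_compact.
apply: bounded_closed_compact; last exact: closed_closure.
have [M [Mr OM]] := bO; exists (M + 1); split; first by rewrite realD.
move=> K MK x cx /=; rewrite leNgt; apply/negP => Kx.
have : nbhs x [set y | K < `|y|].
  apply: open_nbhs_nbhs; split => //.
  rewrite -[[set y | _]]/((fun y : 'rV[R]_N => `|y|) @^-1` [set r | K < r]).
  by apply: open_comp => [y _|]; [exact: norm_continuous|exact: open_gt].
move=> /cx [y [/OM h /=]]; rewrite ltNge => /negP; apply; apply: h.
by rewrite (lt_trans _ MK)// ltrDl.
Qed.

Lemma closure_extendable_bounded I F a b : `[a, b]%classic `<=` I ->
  closure_extendable I F ->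
  exists2 C, 0 <= C & forall t x, a <= t <= b -> Omega x -> `|F t x| <= C.
Proof.
move=> abI /(closure_extendableW abI) [g [cg gE]].
have /compact_bounded[M [_ gM]] := continuous_compact cg (@compact_cylinder a b).
exists `|M + 1| => // t x tab Ox; rewrite -gE//.
have := gM (M + 1); rewrite ltrDl ltr01 => /(_ isT) h.
apply: (le_trans _ (ler_norm _)); apply: h; exists (t, x) => //; split => /=.
  by rewrite in_itv.
exact: subset_closure.
Qed.

(** Compactness is used in covering form: [P d p] says that [d] is a modulus of continuity in time
    at the point [p], and it holds near each point of the cylinder for all small [d]. *)
Lemma closure_extendable_equicontinuous I F a b : `[a, b]%classic `<=` I ->
  closure_extendable I F -> forall eps, 0 < eps -> exists2 delta, 0 < delta &
    forall s t x, a <= s <= b -> a <= t <= b -> `|s - t| < delta -> Omega x ->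
      `|F s x - F t x| <= eps.
Proof.
move=> abI /(closure_extendableW abI) [g [cg gE]] eps eps0.
pose K := `[a, b]%classic `*` closure Omega.
pose P (d : R) (p : R * 'rV[R]_N) := forall s, a <= s <= b -> `|s - p.1| < d ->
  `|g (s, p.2) - g p| <= eps.
have := @compact_cylinder a b; rewrite -/K => /compact_near_coveringP/near_covering_withinP.
move=> /(_ R 0^'+ P _) [].
  move=> [t0 x0] K0; have e2 : 0 < eps / 2 by rewrite divr_gt0.
  have /subspace_continuousP/(_ _ K0)/cvgrPdist_lt/(_ _ e2) := cg.
  rewrite near_withinE => /nbhs_ballP[r /= r0 rK].
  have r2 : 0 < r / 2 by rewrite divr_gt0.
  near=> z d => -[/= zt zx] s sab /= sz.
  have zb : ball (t0, x0) (r / 2) z by near: z; exact: nbhsx_ballx.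
  have dr : d < r / 2 by near: d; exact: nbhs_right_lt.
  have h1 : `|g (t0, x0) - g z| < eps / 2.
    by apply: (rK z) => //; apply: (le_ball _ zb); rewrite ler_pdivrMr// ler_pMr// ler1n.
  have h2 : `|g (t0, x0) - g (s, z.2)| < eps / 2.
    apply: (rK (s, z.2)); last by split => //=; rewrite in_itv.
    split => /=; last first.
      by apply: (le_ball _ zb.2); rewrite ler_pdivrMr// ler_pMr// ler1n.
    have := zb.1; rewrite /ball/= => z1.
    have := ler_distD z.1 t0 s => /le_lt_trans; apply; rewrite (splitr r) ltrD//.
    by rewrite distrC (lt_trans sz).
  rewrite (le_trans (ler_distD (g (t0, x0)) _ _))// (splitr eps).
  by rewrite lerD// ltW// distrC.
move=> d [/= d0 dK]; exists (d / 2); first by rewrite divr_gt0.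
move=> s t x sab tab st Ox; rewrite -!gE//.
have d2 : d / 2 < d by rewrite ltr_pdivrMr// ltr_pMr// ltr1n.
apply: (dK (d / 2) _ _ (t, x)) => //=.
- by rewrite sub0r normrN ger0_norm// divr_ge0// ltW.
- by rewrite divr_gt0.
by split => /=; [rewrite in_itv|exact: subset_closure].
Unshelve. all: by end_near. Qed.

(** A point of [Omega] has a neighbourhood inside [Omega], so continuity within the cylinder gives
    full continuity in [x]. *)
Lemma closure_extendable_continuous I F t : I t -> closure_extendable I F ->
  forall x, Omega x -> {for x, continuous (F t)}.
Proof.
move=> It [g [cg gE]] x Ox.
have /subspace_continuousP/(_ (t, x) (conj It (@subset_closure _ _ _ Ox))) gc := cg.
have nO : nbhs x Omega by exact: open_nbhs_nbhs.
have c1 : g (t, y) @[y --> x] --> g (t, x).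
  apply: (cvg_comp _ _ _ gc) => B [[U V] /= [Ut Vx] UVB].
  apply: filterS (filterI Vx nO) => y [Vy Oy]; apply: (UVB (t, y)).
    by split => //; exact: nbhs_singleton.
  by split => //; exact: subset_closure.
have c2 : F t y @[y --> x] --> F t x.
  rewrite -(gE t x)//; apply: cvg_trans c1.
  have FF : Filter (nbhs x) := nbhs_filter x.
  have E : \forall y \near x, g (t, y) = F t y by apply: filterS nO => y Oy; rewrite gE.
  exact: (near_eq_cvg E).
exact: c2.
Qed.

Lemma closure_extendable_bounded_continuous I F t : I t ->
  closure_extendable I F -> bounded_continuous Omega (F t).
Proof.
move=> It cF; split; first exact: (closure_extendable_continuous It cF).
have tI : `[t, t]%classic `<=` I.
  by move=> s /=; rewrite in_itv/= => /andP[ts st]; rewrite (@le_anti _ _ s t)// st ts.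
have [C _ FC] := closure_extendable_bounded tI cF.
by exists C => x Ox; apply: FC; rewrite ?lexx.
Qed.

End closure_extendable.

(** * Calculus of iterated derivatives, regularity classes and boundary conditions *)

Section Ck_calculus.
Context {R : realType} {N : nat} (Omega : set 'rV[R]_N).
Hypothesis oO : open Omega.
Implicit Types (I : set R) (f g : R -> 'rV[R]_N -> R) (u w : 'rV[R]_N -> R).

(** Derivatives are local and [Omega] is open, so the arbitrary values outside [Omega] do not
    matter. *)
Lemma eq_pderiv_in u w s x : (forall y, Omega y -> u y = w y) -> Omega x ->
  pderiv s u x = pderiv s w x.
Proof.
move=> uw; elim: s x => [|i s IH] x Ox /=; first exact: uw.
apply: near_eq_derive; near=> y; apply: IH; near: y.
exact: open_nbhs_nbhs.
Unshelve. all: by end_near. Qed.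

Lemma eq_derive_in u w i x : (forall y, Omega y -> u y = w y) -> Omega x ->
  'D_(evec i) u x = 'D_(evec i) w x.
Proof. exact: (@eq_pderiv_in u w [:: i]). Qed.

Lemma eq_laplacian_in u w x : (forall y, Omega y -> u y = w y) -> Omega x ->
  laplacian u x = laplacian w x.
Proof. by move=> uw Ox; apply: eq_bigr => i _; exact: eq_pderiv_in. Qed.

Lemma eq_polylaplacian_in m u w x : (forall y, Omega y -> u y = w y) -> Omega x ->
  polylaplacian m u x = polylaplacian m w x.
Proof.
move=> uw; elim: m x => [|m IH] x Ox; first exact: uw.
by rewrite /polylaplacian !iterS; exact: eq_laplacian_in.
Qed.

Lemma eq_sqr_norm_Dtilde_in m u w x : (forall y, Omega y -> u y = w y) -> Omega x ->
  sqr_norm_Dtilde m u x = sqr_norm_Dtilde m w x.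
Proof.
move=> uw Ox; rewrite /sqr_norm_Dtilde; case: ifP => _.
  apply: eq_bigr => i _; congr (_ ^+ 2).
  by apply: eq_derive_in => // y; exact: eq_polylaplacian_in.
by congr (_ ^+ 2); exact: eq_polylaplacian_in.
Qed.

Lemma eq_energy_in m u w : (forall y, Omega y -> u y = w y) ->
  energy m Omega u = energy m Omega w.
Proof.
move=> uw; rewrite /energy; congr (- _ + _); apply: eq_integralN => x Ox.
  exact: eq_sqr_norm_Dtilde_in.
by rewrite uw.
Qed.

(** The last letter of a word is the innermost derivative, so no commutation of partial derivatives
    is involved. *)
Lemma pderiv_derive s i u : pderiv s ('D_(evec i) u) = pderiv (rcons s i) u.
Proof. by rewrite /pderiv foldr_rcons. Qed.

Lemma Ck_closure_timeW k l I f : (l <= k)%N ->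
  Ck_closure_time k Omega I f -> Ck_closure_time l Omega I f.
Proof.
move=> lk [df cf]; split=> [s i t x sl|s sl]; first by apply: df; exact: leq_trans lk.
by apply: cf; exact: leq_trans lk.
Qed.

Lemma Ck_closure_time_extendable k I f s : (size s <= k)%N ->
  Ck_closure_time k Omega I f -> closure_extendable Omega I (fun t => pderiv s (f t)).
Proof. by move=> sk [_ /(_ s sk)]. Qed.

Lemma Ck_closure_time_slice k I f t : I t ->
  Ck_closure_time k Omega I f -> Ck_closure_time k Omega setT (fun=> f t).
Proof.
move=> It [df cf]; split=> [s i _ x sk _ Ox|s sk]; first exact: df.
exact: (closure_extendable_slice It (cf s sk)).
Qed.

Lemma Ck_closure_time_derive k I f i : Ck_closure_time k.+1 Omega I f ->
  Ck_closure_time k Omega I (fun t => 'D_(evec i) (f t)).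
Proof.
move=> [df cf]; split=> [s j t x sk It Ox|s sk].
  by rewrite pderiv_derive; apply: df => //; rewrite size_rcons.
have [|g [cg gE]] := cf (rcons s i); first by rewrite size_rcons.
by exists g; split=> // t x It Ox; rewrite pderiv_derive gE.
Qed.

Lemma pderiv_sum n (F : 'I_n -> 'rV[R]_N -> R) s x :
  (forall j s' i y, (size s' < size s)%N -> Omega y ->
    derivable (pderiv s' (F j)) y (evec i)) ->
  Omega x -> pderiv s (fun y => \sum_j F j y) x = \sum_j pderiv s (F j) x.
Proof.
elim: s x => [|i s IH] x //= dF Ox.
have -> : 'D_(evec i) (pderiv s (fun y => \sum_j F j y)) x =
          'D_(evec i) (\sum_j pderiv s (F j)) x.
  apply: near_eq_derive; near=> y; rewrite fct_sumE; apply: IH.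
    by move=> j s' i' z s's; apply: dF; exact: ltnW.
  by near: y; exact: open_nbhs_nbhs.
by rewrite derive_sum// => j; exact: dF.
Unshelve. all: by end_near. Qed.

Lemma Ck_closure_time_sum k I n (F : 'I_n -> R -> 'rV[R]_N -> R) :
  (forall j, Ck_closure_time k Omega I (F j)) ->
  Ck_closure_time k Omega I (fun t x => \sum_j F j t x).
Proof.
move=> CF; have pE s t x : (size s <= k)%N -> I t -> Omega x ->
    pderiv s (fun y => \sum_j F j t y) x = \sum_j pderiv s (F j t) x.
  move=> sk It Ox; apply: pderiv_sum => // j s' i y s's Oy.
  by apply: (CF j).1 => //; exact: leq_trans sk.
split=> [s i t x sk It Ox|s sk].
  apply: (@near_eq_derivable _ _ _ (\sum_j pderiv s (F j t))).
    near=> y; rewrite fct_sumE pE//; first exact: ltnW.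
    by near: y; exact: open_nbhs_nbhs.
  by apply: derivable_sum => j; exact: (CF j).1.
have [g [cg gE]] := closure_extendable_sum (fun j => Ck_closure_time_extendable sk (CF j)).
by exists g; split=> // t x It Ox; rewrite pE// gE.
Unshelve. all: by end_near. Qed.

Lemma Ck_closure_time_laplacian k I f : Ck_closure_time k.+2 Omega I f ->
  Ck_closure_time k Omega I (fun t => laplacian (f t)).
Proof.
move=> Cf; apply: (@Ck_closure_time_sum _ _ _ (fun i t => pderiv [:: i; i] (f t))) => i.
exact/Ck_closure_time_derive/Ck_closure_time_derive.
Qed.

Lemma Ck_closure_time_polylaplacian j k I f :
  Ck_closure_time (j.*2 + k) Omega I f ->
  Ck_closure_time k Omega I (fun t => polylaplacian j (f t)).
Proof.
elim: j k => [|j IH] k Cf; first exact: Cf.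
by apply/Ck_closure_time_laplacian/IH; rewrite !addnS.
Qed.

Lemma dirichlet_bcW m k u : (k <= m)%N -> dirichlet_bc m Omega u -> dirichlet_bc k Omega u.
Proof. by move=> km bu s p sk; apply: bu; exact: leq_trans km. Qed.

Lemma dirichlet_bc_derive m u i : dirichlet_bc m.+1 Omega u ->
  dirichlet_bc m Omega ('D_(evec i) u).
Proof. by move=> bu s p sm Op; rewrite pderiv_derive; apply: bu => //; rewrite size_rcons. Qed.

(** The regularity of [u] serves to differentiate the sum of second derivatives termwise inside
    [Omega]; each term then tends to 0 at the boundary. *)
Lemma dirichlet_bc_laplacian m k u : (m <= k)%N ->
  Ck_closure_time k.+2 Omega setT (fun=> u) ->
  dirichlet_bc m.+2 Omega u -> dirichlet_bc m Omega (laplacian u).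
Proof.
move=> mk Cu bu s p sm Op.
have sE x : Omega x -> pderiv s (laplacian u) x = \sum_i pderiv s (pderiv [:: i; i] u) x.
  move=> Ox; apply: pderiv_sum => // j s' i y s's Oy.
  have /Ck_closure_time_derive C1 := Cu.
  have [/(_ s' i 0 y _ I Oy) + _] := Ck_closure_time_derive j (C1 j).
  by apply; rewrite (leq_trans s's)// (leq_trans (ltnW sm)).
have W : Filter (within Omega (nbhs p)) by apply: within_filter; exact: nbhs_filter.
have c0 : (\sum_i pderiv s (pderiv [:: i; i] u) x) @[x --> within Omega (nbhs p)] --> (0 : R).
  elim: (index_enum _) => [|i r IHr].
    by under eq_cvg do rewrite big_nil; exact: cvg_cst.
  have ci := dirichlet_bc_derive i (dirichlet_bc_derive i bu) sm Op.
  under eq_cvg do rewrite big_cons.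
  by have := cvgD (FF := W) ci IHr; rewrite addr0; apply.
apply: cvg_trans c0; apply: near_eq_cvg; rewrite near_withinE.
by apply: nearW => x Ox; rewrite sE.
Qed.

Lemma dirichlet_bc_polylaplacian j m k u : (m <= k)%N ->
  Ck_closure_time (j.*2 + k) Omega setT (fun=> u) ->
  dirichlet_bc (j.*2 + m) Omega u -> dirichlet_bc m Omega (polylaplacian j u).
Proof.
elim: j m k => [|j IH] m k mk Cu bu; first exact: bu.
apply: (dirichlet_bc_laplacian mk).
  by apply: Ck_closure_time_polylaplacian; rewrite !addnS.
by apply: (IH _ k.+2) => //; rewrite !addnS.
Qed.

End Ck_calculus.

(** * Green's formulas for the iterated Laplacian *)

Section green.
Context {R : realType} {N : nat} (Omega : set 'rV[R]_N).
Hypotheses (oO : open Omega) (bO : bounded_set Omega).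
Implicit Types u w : 'rV[R]_N -> R.

Local Notation Ck k u := (Ck_closure_time k Omega setT (fun=> u)).

Lemma eq_bounded_continuous u w : (forall x, Omega x -> u x = w x) ->
  bounded_continuous Omega u -> bounded_continuous Omega w.
Proof.
move=> uw [cu [C uC]]; split; last by exists C => x Ox; rewrite -uw// uC.
suff h (x : 'rV[R]_N) : Omega x -> w y @[y --> x] --> w x by exact: h.
move=> Ox; have FF : Filter (nbhs x) := nbhs_filter x.
have E : \forall y \near x, u y = w y.
  by apply: filterS (open_nbhs_nbhs (conj oO Ox)) => y; exact: uw.
by rewrite -uw//; exact: (cvg_trans (near_eq_cvg E) (cu x Ox)).
Qed.

Lemma Ck_bounded_continuous k u s : (size s <= k)%N -> Ck k u ->
  bounded_continuous Omega (pderiv s u).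
Proof.
move=> sk Cu; have E := Ck_closure_time_extendable sk Cu.
exact: (@closure_extendable_bounded_continuous _ _ _ oO bO setT _ 0 I E).
Qed.

(** The product [u * w] tends to 0 at the boundary because [u] does and [w] is bounded, so
    [integral_derive_zero] applies to it. *)
Lemma integral_by_parts u w i : Ck 1 u -> Ck 1 w -> dirichlet_bc 1 Omega u ->
  integralN Omega (fun x => 'D_(evec i) u x * w x) =
  - integralN Omega (fun x => u x * 'D_(evec i) w x).
Proof.
move=> Cu Cw bu.
have b_u : bounded_continuous Omega u.
  by exact: (@Ck_bounded_continuous 1 u [::]).
have b_w : bounded_continuous Omega w.
  by exact: (@Ck_bounded_continuous 1 w [::]).
have b_du : bounded_continuous Omega ('D_(evec i) u).
  by exact: (@Ck_bounded_continuous 1 u [:: i]).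
have b_dw : bounded_continuous Omega ('D_(evec i) w).
  by exact: (@Ck_bounded_continuous 1 w [:: i]).
have b1 := bounded_continuousM b_du b_w; have b2 := bounded_continuousM b_u b_dw.
have du x : Omega x -> derivable u x (evec i) by move=> Ox; exact: (Cu.1 [::] i 0).
have dw x : Omega x -> derivable w x (evec i) by move=> Ox; exact: (Cw.1 [::] i 0).
have dE x : Omega x -> 'D_(evec i) u x * w x + u x * 'D_(evec i) w x = 'D_(evec i) (u * w) x.
  move=> Ox; rewrite deriveM; [|exact: du|exact: dw].
  by rewrite addrC; congr (_ + _); rewrite mulrC.
apply/eqP; rewrite -subr_eq0 opprK -(integralN_D oO bO)//; apply/eqP.
rewrite (eq_integralN dE); apply: integral_derive_zero => //.
- by move=> x Ox; apply: derivableM; [exact: du|exact: dw].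
- exact: bounded_continuousM.
- by apply: (eq_bounded_continuous dE); exact: bounded_continuousD.
move=> p Op; have [_ [C wC]] := b_w.
have W : Filter (within Omega (nbhs p)) by apply: within_filter; exact: nbhs_filter.
apply/cvgrPdist_lt => eps eps0.
have C0 : 0 < `|C| + 1 by rewrite ltr_wpDl.
have /cvgrPdist_lt/(_ (eps / (`|C| + 1)) (divr_gt0 eps0 C0)) := bu [::] p isT Op.
rewrite !near_withinE; apply: filterS => x h Ox; have := h Ox.
rewrite !sub0r !normrN /= normrM ltr_pdivlMr// => /le_lt_trans; apply.
by rewrite ler_wpM2l// (le_trans (wC x Ox))// (le_trans (ler_norm C))// lerDl.
Qed.

Let dot_grad u w x := \sum_(i < N) 'D_(evec i) u x * 'D_(evec i) w x.

(** The vanishing factor is a first derivative of [u], which takes two orders of boundary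
    conditions; in [green_laplacian_r] it is [u] itself, and one order is enough. *)
Lemma green_laplacian_l u w : Ck 2 u -> Ck 1 w -> dirichlet_bc 2 Omega u ->
  integralN Omega (fun x => laplacian u x * w x) = - integralN Omega (dot_grad u w).
Proof.
move=> Cu Cw bu.
have Cdu i : Ck 1 ('D_(evec i) u) by exact: Ck_closure_time_derive.
have b_w : bounded_continuous Omega w.
  by exact: (@Ck_bounded_continuous 1 w [::]).
have bdu i : bounded_continuous Omega ('D_(evec i) u).
  by exact: (@Ck_bounded_continuous 2 u [:: i]).
have bdw i : bounded_continuous Omega ('D_(evec i) w).
  by exact: (@Ck_bounded_continuous 1 w [:: i]).
have bddu i : bounded_continuous Omega (pderiv [:: i; i] u).
  by exact: (@Ck_bounded_continuous 2 u).
under [LHS]eq_integralN do rewrite /laplacian mulr_suml.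
rewrite (integralN_sum oO bO) => [|i]; last exact: bounded_continuousM.
rewrite (integralN_sum oO bO) => [|i]; last exact: bounded_continuousM.
rewrite -sumrN; apply: eq_bigr => i _; apply: (@integral_by_parts ('D_(evec i) u)) => //.
exact: dirichlet_bc_derive.
Qed.

Lemma green_laplacian_r u w : Ck 1 u -> Ck 2 w -> dirichlet_bc 1 Omega u ->
  integralN Omega (fun x => u x * laplacian w x) = - integralN Omega (dot_grad u w).
Proof.
move=> Cu Cw bu.
have Cdw i : Ck 1 ('D_(evec i) w) by exact: Ck_closure_time_derive.
have b_u : bounded_continuous Omega u.
  by exact: (@Ck_bounded_continuous 1 u [::]).
have bdu i : bounded_continuous Omega ('D_(evec i) u).
  by exact: (@Ck_bounded_continuous 1 u [:: i]).
have bdw i : bounded_continuous Omega ('D_(evec i) w).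
  by exact: (@Ck_bounded_continuous 2 w [:: i]).
have bddw i : bounded_continuous Omega (pderiv [:: i; i] w).
  by exact: (@Ck_bounded_continuous 2 w).
under [LHS]eq_integralN do rewrite /laplacian mulr_sumr.
rewrite (integralN_sum oO bO) => [|i]; last exact: bounded_continuousM.
rewrite (integralN_sum oO bO) => [|i]; last exact: bounded_continuousM.
rewrite -sumrN; apply: eq_bigr => i _.
by rewrite (@integral_by_parts u ('D_(evec i) w))// opprK.
Qed.

(** The outermost Laplacian on [u] becomes the innermost one on [w] by the two Green formulas. All
    boundary conditions are put on [u], so the induction can replace [w] by [laplacian w]. *)
Lemma polylaplacian_selfadjoint j u w : Ck j.*2 u -> Ck j.*2 w ->
  dirichlet_bc j.*2 Omega u ->
  integralN Omega (fun x => polylaplacian j u x * w x) =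
  integralN Omega (fun x => u x * polylaplacian j w x).
Proof.
elim: j w => [|j IH] w Cu Cw bu; first by [].
have CU : Ck 2 (polylaplacian j u).
  by apply: (@Ck_closure_time_polylaplacian _ _ _ oO j 2 _ (fun=> u)); rewrite addn2.
have bU : dirichlet_bc 2 Omega (polylaplacian j u).
  by apply: (@dirichlet_bc_polylaplacian _ _ _ oO j 2 2); rewrite ?addn2.
have C2w : Ck 2 w by apply: Ck_closure_timeW Cw.
transitivity (integralN Omega (fun x => polylaplacian j u x * laplacian w x)).
  rewrite green_laplacian_r//; last exact: dirichlet_bcW bU.
    by rewrite -green_laplacian_l//; exact: Ck_closure_timeW C2w.
  exact: Ck_closure_timeW CU.
have -> : polylaplacian j.+1 w = polylaplacian j (laplacian w) by rewrite /polylaplacian iterSr.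
apply: IH.
- by apply: Ck_closure_timeW Cu; rewrite doubleS -addn2 leq_addr.
- by apply: (@Ck_closure_time_laplacian _ _ _ oO _ _ (fun=> w)).
- by apply: dirichlet_bcW bu; rewrite doubleS -addn2 leq_addr.
Qed.

(** The symmetric bilinear form whose diagonal is [sqr_norm_Dtilde m]. *)
Let Dtilde_dot m u w x :=
  if odd m then dot_grad (polylaplacian m./2 u) (polylaplacian m./2 w) x
  else polylaplacian m./2 u x * polylaplacian m./2 w x.

Let Dtilde_dotC m u w x : Dtilde_dot m u w x = Dtilde_dot m w u x.
Proof.
rewrite /Dtilde_dot /dot_grad; case: ifP => _; last exact: mulrC.
by apply: eq_bigr => i _; rewrite mulrC.
Qed.

(** Only the Laplacians falling on [u], half of the total, are moved, which stays within the [m]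
    boundary conditions on [u]. For odd [m] the gradient takes one more integration by parts, the
    source of the sign. *)
Let integral_Dtilde_dot m u w : Ck m.*2 u -> Ck m.*2 w -> dirichlet_bc m Omega u ->
  integralN Omega (Dtilde_dot m u w) =
  (-1) ^+ m * integralN Omega (fun x => u x * polylaplacian m w x).
Proof.
move=> Cu Cw bu; pose k := m./2.
have mE : m = (odd m + k.*2)%N by rewrite odd_double_half.
have C1 z l : Ck m.*2 z -> (k.*2 + l <= m.*2)%N -> Ck l (polylaplacian k z).
  move=> Cz h; apply: (@Ck_closure_time_polylaplacian _ _ _ oO k l _ (fun=> z)).
  exact: Ck_closure_timeW Cz.
have Ck2 l z : (l <= m.*2)%N -> Ck m.*2 z -> Ck l z by exact: Ck_closure_timeW.
have b2 l : (l <= m)%N -> dirichlet_bc l Omega u by move=> lm; exact: dirichlet_bcW bu.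
rewrite /Dtilde_dot -/k;
have [om|/negbTE om] := boolP (odd m); rewrite om /= in mE *; clearbody k.
  have bU : dirichlet_bc 1 Omega (polylaplacian k u).
    by apply: (@dirichlet_bc_polylaplacian _ _ _ oO k 1 1) => //;
      [apply: Ck2 => //; lia|apply: b2; lia].
  have C2w : Ck 2 (polylaplacian k w) by apply: C1 => //; lia.
  have CU : Ck 1 (polylaplacian k u) by apply: C1 => //; lia.
  have := green_laplacian_r CU C2w bU => /(congr1 -%R); rewrite opprK => <-.
  rewrite -[laplacian _]/(polylaplacian k.+1 w) -signr_odd om expr1 mulN1r.
  congr (- _).
  have -> : polylaplacian m w = polylaplacian k (polylaplacian k.+1 w).
    by rewrite /polylaplacian -iterD; congr iter; lia.
  rewrite polylaplacian_selfadjoint//; [apply: Ck2 => //; lia| |apply: b2; lia].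
  apply: (@Ck_closure_time_polylaplacian _ _ _ oO k.+1 k.*2 _ (fun=> w)).
  by apply: Ck2 => //; lia.
rewrite -signr_odd om expr0 mul1r.
have -> : polylaplacian m w = polylaplacian k (polylaplacian k w).
  by rewrite /polylaplacian -iterD; congr iter; lia.
rewrite polylaplacian_selfadjoint//; [apply: Ck2 => //; lia| |apply: b2; lia].
by apply: C1 => //; lia.
Qed.

Lemma integral_sqr_norm_Dtilde m u : Ck m.*2 u -> dirichlet_bc m Omega u ->
  integralN Omega (sqr_norm_Dtilde m u) =
  (-1) ^+ m * integralN Omega (fun x => u x * polylaplacian m u x).
Proof.
by move=> Cu bu; rewrite -integral_Dtilde_dot.
Qed.

(** Up to the common sign (-1)^m, both sides are integrals of the symmetric form [Dtilde_dot]. *)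
Lemma integral_polylaplacianC m u w : Ck m.*2 u -> Ck m.*2 w ->
  dirichlet_bc m Omega u -> dirichlet_bc m Omega w ->
  integralN Omega (fun x => u x * polylaplacian m w x) =
  integralN Omega (fun x => w x * polylaplacian m u x).
Proof.
move=> Cu Cw bu bw; apply: (@mulfI _ ((-1) ^+ m)); first by rewrite signr_eq0.
rewrite -!integral_Dtilde_dot//.
by apply: eq_integralN => x _; exact: Dtilde_dotC.
Qed.

End green.

(** * Inequalities for real powers *)

Section powers.
Context {R : realType}.
Implicit Types (a b r M : R).

Lemma powR1D r a : 0 <= r -> 0 <= a -> a `^ (r + 1) = a `^ r * a.
Proof.
move=> r0 a0; rewrite powRD ?powRr1//.
by rewrite gt_eqF ?ltr_wpDl.
Qed.

(* The convex function x |-> x^(r+1) lies above its tangent at b. *)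
Lemma powR_tangent r a b : 0 < r -> 0 <= a -> 0 <= b ->
  (r + 1) * (b `^ r * a) <= r * b `^ (r + 1) + a `^ (r + 1).
Proof.
move=> r0 a0 b0; have r1 : 0 < r + 1 by rewrite addr_gt0.
(* Young's inequality for a and b^r, with conjugate exponents r + 1 and (r + 1) / r. *)
have := @conjugate_powR R a (b `^ r) (r + 1) ((r + 1) / r) a0 (powR_ge0 _ _) r1.
rewrite divr_gt0// => /(_ isT); rewrite invf_div -powRrM.
have -> : r * ((r + 1) / r) = r + 1 by rewrite mulrC divfK// gt_eqF.
have -> : (r + 1)^-1 + r / (r + 1) = 1.
  by rewrite -[X in X + _]mul1r -mulrDl addrC divff// gt_eqF.
move=> /(_ erefl) h.
apply: (@le_trans _ _ ((r + 1) * (a `^ (r + 1) / (r + 1) + b `^ (r + 1) * (r / (r + 1))))).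
  by rewrite ler_wpM2l ?(ltW r1)// mulrC.
by rewrite le_eqVlt; apply/orP; left; apply/eqP; field; rewrite gt_eqF.
Qed.

(** When |b| <= |a|, the tangent at |a| bounds the difference by (r + 1) |a|^r (|a| - |b|), and
    |a|^r is at most |M|^r. *)
Lemma lipschitz_norm_powR r M : 0 < r -> exists2 L, 0 <= L & forall a b,
  `|a| <= M -> `|b| <= M -> `| `|a| `^ (r + 1) - `|b| `^ (r + 1)| <= L * `|a - b|.
Proof.
move=> r0; have r1 : 0 <= r + 1 by rewrite addr_ge0// ltW.
exists ((r + 1) * `|M| `^ r); first by rewrite mulr_ge0// powR_ge0.
move=> a b aM bM; wlog ba : a b aM bM / `|b| <= `|a|.
  move=> h; have [ba|/ltW ab] := leP `|b| `|a|; first exact: h.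
  by rewrite distrC [`|a - b|]distrC; exact: h.
have mon : `|b| `^ (r + 1) <= `|a| `^ (r + 1) by rewrite ge0_ler_powR ?nnegrE.
rewrite ger0_norm ?subr_ge0//.
have := powR_tangent r0 (normr_ge0 b) (normr_ge0 a).
have := powR1D (ltW r0) (normr_ge0 a); set A := `|a| `^ r => E T; rewrite E in T *.
have AM : A <= `|M| `^ r by rewrite ge0_ler_powR ?nnegrE ?(ltW r0)// (le_trans aM)// ler_norm.
have A0 : 0 <= A by exact: powR_ge0.
apply: (@le_trans _ _ ((r + 1) * A * (`|a| - `|b|))); first by lra.
by apply: ler_pM; rewrite ?subr_ge0 ?mulr_ge0// ?ler_wpM2l// lerB_dist.
Qed.

End powers.

(** * The nonlinearity [psi]: inverse, monotonicity, convexity of the potential *)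

Section psi_inequalities.
Context {R : realType}.
Variable n : R.
Hypothesis n0 : 0 < n.
Implicit Types (v w M : R).

Let n1 : 0 < n + 1. Proof. by rewrite addr_gt0. Qed.
Let n1n0 : n + 1 != 0. Proof. by rewrite gt_eqF. Qed.

Lemma norm_psi v : `|psi n v| = `|v| `^ (n + 1)^-1.
Proof.
rewrite /psi normrM (ger0_norm (powR_ge0 _ _)).
have [->|v0] := eqVneq v 0; first by rewrite normr0 mulr0 powR0// invr_eq0.
rewrite -[X in _ * X]powRr1// -powRD; last by rewrite normr_eq0 v0 implybT.
by congr (_ `^ _); field.
Qed.

(** With u = psi(v) this is v = |u|^n u: the powers n/(n+1) and -n/(n+1) of |v| cancel, and at v = 0
    both sides vanish. *)
Lemma psiK v : `|psi n v| `^ n * psi n v = v.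
Proof.
rewrite norm_psi /psi mulrA -powRrM.
have [->|v0] := eqVneq v 0; first by rewrite mulr0.
rewrite -powRD; last by rewrite normr_eq0 v0 implybT.
by rewrite (_ : _ + _ = 0) ?powRr0 ?mul1r//; field.
Qed.

(** In the variables u = psi(v), z = psi(w), replacing u z by |u| |z| in the expanded product can
    only lower it, and leaves (|u|^n |u| - |z|^n |z|) (|u| - |z|), whose factors have the same
    sign. *)
Lemma psi_monotone v w : 0 <= (v - w) * (psi n v - psi n w).
Proof.
rewrite -{1}(psiK v) -{1}(psiK w); set u := psi n v; set z := psi n w.
wlog zu : u z / `|z| <= `|u|.
  move=> h; have [zu|/ltW uz] := leP `|z| `|u|; first exact: h.
  by rewrite -mulrNN !opprB; exact: h.
have mon : `|z| `^ n <= `|u| `^ n by rewrite ge0_ler_powR ?nnegrE ?(ltW n0).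
move: mon; set A := `|u| `^ n; set B := `|z| `^ n => BA.
have A0 : 0 <= A := powR_ge0 _ _; have B0 : 0 <= B := powR_ge0 _ _.
have uz : u * z <= `|u| * `|z| by rewrite -normrM ler_norm.
have -> : (A * u - B * z) * (u - z) = A * u ^+ 2 + B * z ^+ 2 - (A + B) * (u * z) by ring.
rewrite -(real_normK (num_real u)) -(real_normK (num_real z)).
apply: (@le_trans _ _ ((A * `|u| - B * `|z|) * (`|u| - `|z|))).
  by rewrite mulr_ge0 ?subr_ge0// ler_pM.
have -> : (A * `|u| - B * `|z|) * (`|u| - `|z|) =
  A * `|u| ^+ 2 + B * `|z| ^+ 2 - (A + B) * (`|u| * `|z|) by ring.
by rewrite lerB// ler_wpM2l// addr_ge0.
Qed.

(** [psi n] is not Lipschitz at 0, but its inverse u |-> |u|^n u has derivative (n + 1) |u|^n, and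
    |u|^n is at most [K] when |v| <= M. *)
Lemma psi_lipschitz_inverse M : exists2 L, 0 <= L & forall v w,
  `|v| <= M -> `|w| <= M -> `|v - w| <= L * `|psi n v - psi n w|.
Proof.
pose K := (`|M| `^ (n + 1)^-1) `^ n.
have K0 : 0 <= K := powR_ge0 _ _.
exists ((n + 1) * K); first by rewrite mulr_ge0 ?(ltW n1).
have key (u z : R) : `|z| <= `|u| -> `|u| `^ n <= K ->
    `| `|u| `^ n * u - `|z| `^ n * z| <= (n + 1) * K * `|u - z|.
  move=> zu uK.
  have mon : `|z| `^ n <= `|u| `^ n by rewrite ge0_ler_powR ?nnegrE ?(ltW n0).
  have := powR_tangent n0 (normr_ge0 z) (normr_ge0 u).
  rewrite !powR1D ?(ltW n0)//; move: mon uK.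
  set A := `|u| `^ n; set B := `|z| `^ n => BA AK T.
  have A0 : 0 <= A := powR_ge0 _ _; have B0 : 0 <= B := powR_ge0 _ _.
  (* The tangent inequality [T] bounds the second term by n A |u - z|, so the two terms add up to (n
     + 1) A |u - z|. *)
  have -> : A * u - B * z = A * (u - z) + (A - B) * z by ring.
  have AB : 0 <= A - B by rewrite subr_ge0.
  rewrite (le_trans (ler_normD _ _))// !normrM (ger0_norm A0) (ger0_norm AB).
  have h : (A - B) * `|z| <= n * A * `|u - z|.
    apply: (@le_trans _ _ (n * A * (`|u| - `|z|))); first by lra.
    by rewrite ler_wpM2l ?mulr_ge0 ?(ltW n0)// lerB_dist.
  apply: (@le_trans _ _ ((n + 1) * A * `|u - z|)); first by lra.
  by rewrite ler_wpM2r// ler_wpM2l// ltW.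
have bK v : `|v| <= M -> `|psi n v| `^ n <= K.
  move=> vM; rewrite ge0_ler_powR ?nnegrE ?powR_ge0 ?(ltW n0)// norm_psi.
  by rewrite ge0_ler_powR ?nnegrE ?invr_ge0 ?(ltW n1)// (le_trans vM)// ler_norm.
move=> v w vM wM; rewrite -{1}(psiK v) -{1}(psiK w).
have [wv|/ltW vw] := leP `|psi n w| `|psi n v|; first by apply: key => //; exact: bK.
by rewrite distrC [X in _ <= _ * X]distrC; apply: key => //; exact: bK.
Qed.

(** With u = psi(v), the potential is |u|^(n+2), convex in u with derivative (n + 2) |u|^n u = (n +
    2) v; this is its tangent inequality at psi(w). *)
Lemma potential_convex v w :
  `|w| `^ ((n + 1)^-1 + 1) + (n + 2) * (w * (psi n v - psi n w)) <=
  `|v| `^ ((n + 1)^-1 + 1).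
Proof.
have pE z : `|z| `^ ((n + 1)^-1 + 1) = `|psi n z| `^ (n + 1 + 1).
  rewrite norm_psi -powRrM; congr (_ `^ _); by field.
rewrite !pE; set U := psi n v; set W := psi n w.
have := powR_tangent n1 (normr_ge0 U) (normr_ge0 W).
have e2 := powR1D (ltW n1) (normr_ge0 W); have e1 := powR1D (ltW n0) (normr_ge0 W).
rewrite e2 e1.
have -> : w * (U - W) = `|W| `^ n * (W * U) - `|W| `^ n * W ^+ 2.
  by rewrite -[w in LHS](psiK w) -/W; ring.
rewrite -(real_normK (num_real W)).
have : W * U <= `|W| * `|U| by rewrite -normrM ler_norm.
move/(ler_wpM2l (powR_ge0 `|W| n)).
set B := `|W| `^ n; set X := `|U| `^ _ => h1 h2.
have := @ler_wpM2l _ (n + 2) _ _ _ h1; rewrite addr_ge0 ?(ltW n0)// => /(_ isT).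
by lra.
Qed.

End psi_inequalities.

(** Cut into equal pieces shorter than [delta], the interval gives local increments that telescope.
    This plays the part of the mean value inequality for a [G] known only through its increments. *)
Lemma increment_lower_bound {R : realType} (G : R -> R) (a b c delta : R) :
  a <= b -> 0 < delta ->
  (forall s t, a <= s -> s <= t -> t <= b -> t - s < delta ->
    c * (t - s) <= G t - G s) ->
  c * (b - a) <= G b - G a.
Proof.
move=> ab d0 loc.
have d1 : 0 < delta / (b - a + 1) by rewrite divr_gt0// ltr_wpDl// subr_ge0.
have [k _ kd] := near_infty_natSinv_lt (PosNum d1).
have {}kd := kd k (leqnn k); rewrite /= in kd.
have ba0 : 0 <= b - a by rewrite subr_ge0.
pose h := (b - a) / k.+1%:R.
have h0 : 0 <= h by rewrite divr_ge0// subr_ge0.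
have hk : h * k.+1%:R = b - a by rewrite divfK.
have hd : h < delta.
  move: kd; rewrite ltr_pdivlMr ?ltr_wpDl// mulrDr mulr1 => /(le_lt_trans _); apply.
  by rewrite /h mulrC lerDl invr_ge0.
have step j : (j <= k.+1)%N -> c * (h * j%:R) <= G (a + h * j%:R) - G a.
  elim: j => [_|j IH jk]; first by rewrite !mulr0 addr0 subrr.
  have tE : a + h * j.+1%:R - (a + h * j%:R) = h by rewrite -natr1; ring.
  have := loc (a + h * j%:R) (a + h * j.+1%:R); rewrite tE => /(_ _ _ _ hd).
  have -> : c * (h * j.+1%:R) = c * (h * j%:R) + c * h by rewrite -natr1; ring.
  move=> H; have {H} : c * h <= G (a + h * j.+1%:R) - G (a + h * j%:R).
    apply: H.
    - by rewrite lerDl mulr_ge0.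
    - by rewrite lerD2l ler_wpM2l// ler_nat.
    - by rewrite -lerBrDl -hk ler_wpM2l// ler_nat.
  by have := IH (ltnW jk); lra.
by have := step k.+1 (leqnn _); rewrite hk subrKC.
Qed.

(** * Energy monotonicity and growth of the potential for an abstract pair [v], [F] *)

Section energy_growth.
Context {R : realType} {N : nat} (Omega : set 'rV[R]_N).
Hypotheses (oO : open Omega) (bO : bounded_set Omega).
Variables (n M : R) (v F : R -> 'rV[R]_N -> R).
Implicit Types (s t a b e xi : R).
Hypotheses (n0 : 0 < n) (M0 : 0 <= M).
Let I : set R := [set t | 0 < t].
Hypotheses (cv : closure_extendable Omega I v) (cF : closure_extendable Omega I F).
Hypothesis dpsi : forall t x, 0 < t -> Omega x ->
  is_derive t 1 (fun tau => psi n (v tau x)) (F t x).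
Hypothesis vM : forall t x, 0 < t -> Omega x -> `|v t x| <= M.
Hypothesis symmetric : forall s t, 0 < s -> 0 < t ->
  integralN Omega (fun x => v t x * F s x) = integralN Omega (fun x => v s x * F t x).

Let E t := integralN Omega (fun x => v t x * F t x).
Let vol := fine (lebesgueN R N (@row_of R N @^-1` Omega)).

Let vol0 : 0 <= vol. Proof. exact: fine_ge0. Qed.

Let bv t : 0 < t -> bounded_continuous Omega (v t).
Proof. by move=> t0; exact: (@closure_extendable_bounded_continuous _ _ _ oO bO I). Qed.

Let bF t : 0 < t -> bounded_continuous Omega (F t).
Proof. by move=> t0; exact: (@closure_extendable_bounded_continuous _ _ _ oO bO I). Qed.

(** The intermediate time [xi] depends on [x], which is why the continuity of [F] in time has to be
    uniform in [x]. *)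
Let psi_increment s t x : 0 < s -> s <= t -> Omega x ->
  exists2 xi, s <= xi <= t & psi n (v t x) - psi n (v s x) = F xi x * (t - s).
Proof.
move=> s0 st Ox.
have d xi : s <= xi -> is_derive xi 1 (fun tau => psi n (v tau x)) (F xi x).
  by move=> sxi; apply: dpsi => //; exact: lt_le_trans sxi.
have [||xi] := @MVT_segment R (fun tau => psi n (v tau x)) (F^~ x) s t st.
- by move=> xi; rewrite in_itv/= => /andP[/ltW sxi _]; exact: d.
- apply: derivable_within_continuous => xi; rewrite in_itv/= => /andP[sxi _].
  exact: (@derive.ex_derive _ _ _ _ _ _ _ (d _ sxi)).
by rewrite in_itv/= => xist eq; exists xi.
Qed.

Let segment_sub a b : 0 < a -> `[a, b]%classic `<=` I.
Proof. by move=> a0 t /=; rewrite in_itv/= => /andP[at_ _]; exact: lt_le_trans at_. Qed.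

(** In the expanded product the cross terms cancel by [symmetric]. *)
Let increment_energy s t : 0 < s -> 0 < t ->
  E t - E s = integralN Omega (fun x => (v t x - v s x) * (F t x + F s x)).
Proof.
move=> s0 t0.
have bb p q : 0 < p -> 0 < q -> bounded_continuous Omega (fun x => v p x * F q x).
  by move=> p0 q0; apply: bounded_continuousM; [exact: bv|exact: bF].
have E1 := integralN_B oO bO (bb _ _ t0 t0) (bb _ _ s0 s0).
have E2 := integralN_B oO bO (bb _ _ t0 s0) (bb _ _ s0 t0).
rewrite symmetric// subrr in E2.
rewrite /E -E1 -[LHS]addr0 -E2 -(integralN_D oO bO).
- by apply: eq_integralN => x _; ring.
- by apply: bounded_continuousB; exact: bb.
- by apply: bounded_continuousB; exact: bb.
Qed.

(** On a short interval F(s) and F(t) are within [eps] of F(xi), and (v(t) - v(s)) F(xi) >= 0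
    because psi is increasing. As v(t) - v(s) is O(t - s) uniformly in [x], the errors add up to a
    multiple of [eps] over the whole interval. *)
Lemma energy_nondecreasing a b : 0 < a -> a <= b -> E a <= E b.
Proof.
move=> a0 ab.
have [L L0 vL] := psi_lipschitz_inverse n0 M.
have [C C0 FC] := closure_extendable_bounded bO (segment_sub (b := b) a0) cF.
(* [eps * K] will be the total loss over the interval from [a] to [b]. *)
pose K := 2 * L * C * vol * (b - a).
have K0 : 0 <= K by rewrite !mulr_ge0// subr_ge0.
apply/ler_addgt0Pr => e e0; pose eps := e / (K + 1).
have K1 : 0 < K + 1 by rewrite ltr_wpDl.
have eps0 : 0 < eps by rewrite divr_gt0.
have [d d0 Fd] := closure_extendable_equicontinuous bO (segment_sub (b := b) a0) cF eps0.
suff h : - (2 * eps * L * C * vol) * (b - a) <= E b - E a.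
  have : eps * (K + 1) = e by rewrite divfK// gt_eqF.
  by rewrite /K; lra.
apply: (increment_lower_bound ab d0) => s t as_ st tb tsd.
have s0 : 0 < s := lt_le_trans a0 as_; have t0 : 0 < t := lt_le_trans s0 st.
rewrite increment_energy//.
have -> : - (2 * eps * L * C * vol) * (t - s) = - (2 * eps * L * C * (t - s)) * vol by ring.
rewrite -(integralN_cst oO); apply: (le_integralN oO bO).
- exact: bounded_continuous_cst.
- apply: bounded_continuousM; first by apply: bounded_continuousB; exact: bv.
  by apply: bounded_continuousD; exact: bF.
move=> x Ox; have [xi /andP[sxi xit] eq] := psi_increment s0 st Ox.
have axi : a <= xi <= b by rewrite (le_trans as_)//= (le_trans xit).
have mon := psi_monotone n0 (v t x) (v s x).
have lip := vL (v t x) (v s x) (vM t0 Ox) (vM s0 Ox).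
rewrite eq in mon lip.
have ts0 : 0 <= t - s by rewrite subr_ge0.
have sab : a <= s <= b by rewrite as_ (le_trans st).
have tab : a <= t <= b by rewrite tb (le_trans as_).
have h1 : `|F t x - F xi x| <= eps.
  by apply: Fd => //; rewrite ger0_norm ?subr_ge0//; apply: le_lt_trans tsd; rewrite lerB.
have h2 : `|F s x - F xi x| <= eps.
  by apply: Fd => //; rewrite distrC ger0_norm ?subr_ge0//; apply: le_lt_trans tsd; rewrite lerB.
set V := v t x - v s x in mon lip *.
have -> : V * (F t x + F s x) =
    2 * (V * F xi x) + V * ((F t x - F xi x) + (F s x - F xi x)) by ring.
(* [mon] gives the sign after division by [t - s]; when [t - s = 0], [lip] forces [V = 0]. *)
have VF : 0 <= V * F xi x.
  have [tseq|ts] := eqVneq (t - s) 0.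
    have : `|V| <= 0 by move: lip; rewrite tseq mulr0 normr0 mulr0.
    by rewrite normr_le0 => /eqP->; rewrite mul0r.
  by move: mon; rewrite mulrA pmulr_lge0// lt_def ts.
have Vb : `|V| <= L * (C * (t - s)).
  rewrite (le_trans lip)// ler_wpM2l// normrM (ger0_norm ts0) ler_wpM2r//.
  exact: FC.
have Vr : `|V * ((F t x - F xi x) + (F s x - F xi x))| <= L * (C * (t - s)) * (eps + eps).
  rewrite normrM ler_pM//; apply: (le_trans (ler_normD _ _)); exact: lerD.
move: Vr; rewrite ler_norml => /andP[Vr _].
by move: Vr VF; set W := V * (_ + _); lra.
Qed.

(** For v = |u|^n u this is |u|^(n+2) written in terms of v. *)
Let pot s : R := `|s| `^ ((n + 1)^-1 + 1).

Let bounded_continuous_pot t : 0 < t -> bounded_continuous Omega (fun x => pot (v t x)).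
Proof.
move=> t0; have q0 : 0 < (n + 1)^-1 by rewrite invr_gt0 addr_gt0.
split; last first.
  exists (pot M) => x Ox; rewrite ger0_norm ?powR_ge0//.
  rewrite ge0_ler_powR ?nnegrE ?addr_ge0 ?(ltW q0)//.
  by rewrite (le_trans (vM t0 Ox))// ler_norm.
suff h (x : 'rV[R]_N) : Omega x -> pot (v t y) @[y --> x] --> pot (v t x) by exact: h.
move=> Ox; have FF : Filter (nbhs x) := nbhs_filter x.
have [L L0 potL] := lipschitz_norm_powR M q0.
have cvx : v t y @[y --> x] --> v t x by exact: (bv t0).1.
apply/cvgrPdist_lt => eps eps0.
have L1 : 0 < L + 1 by rewrite ltr_wpDl.
move/cvgrPdist_lt : cvx => /(_ _ (divr_gt0 eps0 L1)).
have nO : nbhs x Omega := open_nbhs_nbhs (conj oO Ox).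
apply: filterS2 nO => y Oy; rewrite ltr_pdivlMr// => h.
apply: (le_lt_trans (potL _ _ (vM t0 Ox) (vM t0 Oy))); apply: le_lt_trans h.
by rewrite mulrC ler_wpM2l// lerDl.
Qed.

(** If the energy stayed above [e], convexity would make [J] grow at rate at least (n + 2) e / 2,
    past its bound [B]. The other half of [e] absorbs the error made in replacing F(xi) by F(s). *)
Lemma energy_not_bounded_below e : 0 < e -> exists2 t, 0 < t & E t < e.
Proof.
move=> e0; apply: contrapT => nE.
have Ee t : 0 < t -> e <= E t.
  by move=> t0; rewrite leNgt; apply/negP => Et; apply: nE; exists t.
pose J t := integralN Omega (fun x => pot (v t x)).
have n2 : 0 < n + 2 by rewrite addr_gt0.
pose B := pot M * vol.
have B0 : 0 <= B by rewrite mulr_ge0// powR_ge0.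
(* Chosen so that the growth of [J] over a time [len] is at least [B + 1]. *)
pose len := (B + 1) / ((n + 2) * (e / 2)).
have c0 : 0 < (n + 2) * (e / 2) by rewrite mulr_gt0// divr_gt0.
have len0 : 0 < len by rewrite divr_gt0// ltr_wpDl.
(* The interval starts at time 1 because [v] and [F] are controlled at positive times only. *)
pose b := 1 + len; have b1 : 1 <= b by rewrite lerDl ltW.
have Mv : 0 < 2 * (M * vol + 1) by rewrite mulr_gt0// ltr_wpDl// mulr_ge0.
(* This makes the error [M * eps * vol] at most [e / 2]. *)
pose eps := e / (2 * (M * vol + 1)); have eps0 : 0 < eps by rewrite divr_gt0.
have [d d0 Fd] := closure_extendable_equicontinuous bO (segment_sub (b := b) ltr01) cF eps0.
have : (n + 2) * (e / 2) * (b - 1) <= J b - J 1.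
  apply: (increment_lower_bound b1 d0) => s t as_ st tb tsd.
  have s0 : 0 < s := lt_le_trans ltr01 as_; have t0 : 0 < t := lt_le_trans s0 st.
  have ts0 : 0 <= t - s by rewrite subr_ge0.
  have bvF : bounded_continuous Omega (fun x => v s x * F s x).
    by apply: bounded_continuousM; [exact: bv|exact: bF].
  have bvFc : bounded_continuous Omega (fun x => v s x * F s x - M * eps).
    by apply: bounded_continuousB => //; exact: bounded_continuous_cst.
  have Mve : M * eps * vol <= e / 2.
    have : eps * (2 * (M * vol + 1)) = e by rewrite divfK// gt_eqF.
    by lra.
  apply: (@le_trans _ _ ((n + 2) * (t - s) * (E s - M * eps * vol))).
    rewrite mulrAC ler_wpM2l//; first by rewrite mulr_ge0// ltW.
    by have := Ee s s0; lra.
  rewrite /E -(integralN_cst oO) -(integralN_B oO bO)//; last exact: bounded_continuous_cst.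
  rewrite -(integralN_Z oO bO)// /J -(integralN_B oO bO)//; [|exact: bounded_continuous_pot..].
  apply: (le_integralN oO bO).
  - exact: bounded_continuousZ.
  - by apply: bounded_continuousB; exact: bounded_continuous_pot.
  move=> x Ox; have [xi /andP[sxi xit] eq] := psi_increment s0 st Ox.
  have := potential_convex n0 (v t x) (v s x); rewrite -/(pot _) -/(pot _) eq => cvx.
  rewrite lerBrDl; apply: le_trans cvx; rewrite lerD2l.
  rewrite -mulrA ler_wpM2l ?(ltW n2)// mulrA mulrC ler_wpM2r//.
  have h2 : `|F s x - F xi x| <= eps.
    apply: Fd => //; rewrite ?as_ ?(le_trans st)//.
      by rewrite (le_trans as_)//= (le_trans xit).
    by rewrite distrC ger0_norm ?subr_ge0//; apply: le_lt_trans tsd; rewrite lerB.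
  have : `|v s x * (F s x - F xi x)| <= M * eps by rewrite normrM ler_pM// vM.
  by rewrite ler_norml => /andP[_]; rewrite mulrBr; lra.
have JB : J b <= B.
  rewrite /B -(integralN_cst oO); apply: (le_integralN oO bO).
  - by apply: bounded_continuous_pot; exact: lt_le_trans b1.
  - exact: bounded_continuous_cst.
  move=> x Ox; rewrite ge0_ler_powR ?nnegrE ?addr_ge0 ?invr_ge0 ?addr_ge0 ?(ltW n0)//.
  by rewrite (le_trans (vM _ Ox)) ?ler_norm//; exact: lt_le_trans b1.
have J0 : 0 <= J 1 by apply: Rintegral_ge0 => t _; exact: powR_ge0.
have -> : (n + 2) * (e / 2) * (b - 1) = B + 1.
  by rewrite /b addrAC subrr add0r /len mulrC divfK// gt_eqF.
by lra.
Qed.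

End energy_growth.

(** * The energy functional: integral formula and behaviour at the initial time *)

Section energy.
Context {R : realType} {N : nat} (Omega : set 'rV[R]_N).
Hypotheses (oO : open Omega) (bO : bounded_set Omega).
Variable m : nat.

Lemma polylaplacian_extendable (J : set R) f :
  Ck_closure_time m.*2 Omega J f ->
  closure_extendable Omega J (fun t => polylaplacian m (f t)).
Proof.
move=> Cf; have C0 : Ck_closure_time 0 Omega J (fun t => polylaplacian m (f t)).
  by apply: Ck_closure_time_polylaplacian => //; rewrite addn0.
exact: (Ck_closure_time_extendable (s := [::]) _ C0).
Qed.

Lemma sqr_norm_Dtilde_extendable (J : set R) f :
  Ck_closure_time m Omega J f ->
  closure_extendable Omega J (fun t => sqr_norm_Dtilde m (f t)).
Proof.
move=> Cf; have mE : (odd m + m./2.*2)%N = m by rewrite odd_double_half.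
have C1 : Ck_closure_time (odd m) Omega J (fun t => polylaplacian m./2 (f t)).
  by apply: Ck_closure_time_polylaplacian => //; rewrite addnC mE.
rewrite /sqr_norm_Dtilde; move: C1; case: (odd m) => C1.
  apply: closure_extendable_sum => i; apply: closure_extendableM;
  exact: (Ck_closure_time_extendable (s := [:: i]) _ C1).
by apply: closure_extendableM; exact: (Ck_closure_time_extendable (s := [::]) _ C1).
Qed.

(** Green's formula gives the leading term the factor -(-1)^m = (-1)^(m+1), which is the sign in the
    equation. *)
Lemma energy_dirichlet u : Ck_closure_time m.*2 Omega setT (fun=> u) ->
  dirichlet_bc m Omega u ->
  energy m Omega u =
  integralN Omega (fun x => u x * ((-1) ^+ m.+1 * polylaplacian m u x + u x)).
Proof.
move=> Cu bu; rewrite /energy integral_sqr_norm_Dtilde//.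
have b_u : bounded_continuous Omega u.
  by exact: (Ck_bounded_continuous oO bO (s := [::]) _ Cu).
have b_Lu : bounded_continuous Omega (polylaplacian m u).
  have E := polylaplacian_extendable Cu.
  exact: (@closure_extendable_bounded_continuous _ _ _ oO bO setT _ 0 I E).
have b1 := bounded_continuousM b_u b_Lu.
rewrite -mulNr -(integralN_Z oO bO)// -(integralN_D oO bO).
- by apply: eq_integralN => x _; rewrite [(-1) ^+ m.+1]exprS; ring.
- exact: bounded_continuousZ.
- exact: bounded_continuousM.
Qed.

(** At time 0 only derivatives up to order [m] are controlled, so [energy_dirichlet] cannot be used
    there; the two integrands of the energy are compared directly, through their equicontinuity on
    [0, 1]. *)
Lemma energy_right_continuous (J : set R) f : `[0, 1]%classic `<=` J ->
  Ck_closure_time m Omega J f -> forall eps, 0 < eps ->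
  exists2 delta, 0 < delta & forall t, 0 <= t -> t <= 1 -> t < delta ->
    energy m Omega (f 0) <= energy m Omega (f t) + eps.
Proof.
move=> J1 Cf eps eps0.
have cS := sqr_norm_Dtilde_extendable Cf.
have cf := Ck_closure_time_extendable (s := [::]) (leq0n m) Cf.
have cQ : closure_extendable Omega J (fun t x => f t x ^+ 2).
  by apply: closure_extendableM; exact: cf.
pose vol := fine (lebesgueN R N (@row_of R N @^-1` Omega)).
have vol0 : 0 <= vol by exact: fine_ge0.
have V0 : 0 < 2 * vol + 1 by rewrite ltr_wpDl// mulr_ge0.
(* Each of the two integrals contributes an error of at most [e * vol]. *)
pose e := eps / (2 * vol + 1); have e0 : 0 < e by rewrite divr_gt0.
have [d1 d10 S1] := closure_extendable_equicontinuous bO J1 cS e0.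
have [d2 d20 Q2] := closure_extendable_equicontinuous bO J1 cQ e0.
exists (Order.min d1 d2); first by rewrite lt_min d10.
move=> t t0 t1; rewrite lt_min => /andP[td1 td2].
have J0 : J 0 by apply: J1; rewrite /= in_itv/= lexx ler01.
have Jt : J t by apply: J1; rewrite /= in_itv/= t0.
have bS s : J s -> bounded_continuous Omega (sqr_norm_Dtilde m (f s)).
  by move=> Js; exact: (closure_extendable_bounded_continuous oO bO Js cS).
have bQ s : J s -> bounded_continuous Omega (fun x => f s x ^+ 2).
  by move=> Js; exact: (closure_extendable_bounded_continuous oO bO Js cQ).
have shift_le u w : bounded_continuous Omega u -> bounded_continuous Omega w ->
    (forall x, Omega x -> u x <= w x + e) ->
    integralN Omega u <= integralN Omega w + e * vol.
  move=> bu bw uw; rewrite -(integralN_cst oO) -(integralN_D oO bO)//.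
    apply: (le_integralN oO bO) => //; apply: bounded_continuousD => //.
    exact: bounded_continuous_cst.
  exact: bounded_continuous_cst.
have near0 (d : R) (g : R -> _ -> R) x :
    (forall (s t : R) x, 0 <= s <= 1 -> 0 <= t <= 1 -> `|s - t| < d ->
    Omega x -> `|g s x - g t x| <= e) -> t < d -> Omega x -> `|g t x - g 0 x| <= e.
  move=> H td Ox; apply: H => //; rewrite ?t0 ?lexx ?ler01//.
  by rewrite subr0 ger0_norm.
have hS : integralN Omega (sqr_norm_Dtilde m (f t)) <=
    integralN Omega (sqr_norm_Dtilde m (f 0)) + e * vol.
  apply: shift_le; [exact: bS|exact: bS|move=> x Ox].
  have := near0 d1 (fun t => sqr_norm_Dtilde m (f t)) x S1 td1 Ox.
  by rewrite ler_norml => /andP[_]; rewrite lerBlDl addrC.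
have hQ : integralN Omega (fun x => f 0 x ^+ 2) <=
    integralN Omega (fun x => f t x ^+ 2) + e * vol.
  apply: shift_le; [exact: bQ|exact: bQ|move=> x Ox].
  have := near0 d2 (fun t x => f t x ^+ 2) x Q2 td2 Ox.
  by rewrite ler_norml => /andP[+ _]; lra.
have : e * (2 * vol + 1) = eps by rewrite divfK// gt_eqF.
by rewrite /energy; move: hS hQ; lra.
Qed.

End energy.

Unset Implicit Arguments.

Theorem proposition2p1 (R : realType) (N m : nat) (n : R)
    (Omega : set 'rV[R]_N) (lambda1 : R) (v0 : 'rV[R]_N -> R)
    (T : \bar R) (v : R -> 'rV[R]_N -> R)
    (N_gt0 : (0 < N)%N) (m_ge2 : (2 <= m)%N) (n_gt0 : 0 < n)
    (Omega_domain : smooth_bounded_domain Omega)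
    (lambda1_first : first_dirichlet_eigenvalue m Omega lambda1)
    (lambda1_lt1 : lambda1 < 1)
    (v0_smooth : Ck_closure m Omega v0)
    (v0_bounded : exists M : R, forall x, Omega x -> `|v0 x| <= M)
    (v0_energy : 0 < energy m Omega v0)
    (T_gt0 : (0 < T)%E)
    (v_solution : classical_solution m n Omega v0 T v) :
  ~ (T = +oo%E /\ uniformly_bounded Omega v).
Proof.
move=> [Too [M vM]]; subst T.
have [_ oO _ bO _] := Omega_domain.
have [C2 C1 eqn bc init] := v_solution.
have ge0 (t : R) : 0 < t -> [set t : R | 0 < t /\ (t%:E < +oo)%E] t by rewrite /= ltry.
pose F t x := (-1) ^+ m.+1 * polylaplacian m (v t) x + v t x.
have Cv t : 0 < t -> Ck_closure_time m.*2 Omega setT (fun=> v t).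
  by move=> /ge0 It; exact: (Ck_closure_time_slice It C2).
have bcv t : 0 < t -> dirichlet_bc m Omega (v t) by move=> t0; apply: bc; rewrite ?ltry.
have cv : closure_extendable Omega [set t | 0 < t] v.
  apply: closure_extendableW ge0 _.
  exact: (Ck_closure_time_extendable (s := [::]) _ C2).
have cL : closure_extendable Omega [set t | 0 < t] (fun t => polylaplacian m (v t)).
  by apply: closure_extendableW ge0 _; exact: polylaplacian_extendable.
have cF : closure_extendable Omega [set t | 0 < t] F.
  apply: closure_extendableD => //; apply: closure_extendableM => //.
  exact: closure_extendable_cst.
have dpsi (t : R) x : 0 < t -> Omega x ->
    is_derive t 1 (fun tau => psi n (v tau x)) (F t x).
  by move=> t0 Ox; apply: eqn; rewrite ?ltry.
have vM' (t : R) x : 0 < t -> Omega x -> `|v t x| <= `|M|.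
  by move=> t0 Ox; rewrite (le_trans (vM t x t0 Ox))// ler_norm.
(* The zero-order part of [F] pairs symmetrically at once, the leading part by Green's formula. *)
have sym (s t : R) : 0 < s -> 0 < t ->
    integralN Omega (fun x => v t x * F s x) = integralN Omega (fun x => v s x * F t x).
  move=> s0 t0.
  have bv r : 0 < r -> bounded_continuous Omega (v r).
    by move=> r0; exact: (closure_extendable_bounded_continuous oO bO (r0 : [set t | 0 < t] r) cv).
  have bL r : 0 < r -> bounded_continuous Omega (polylaplacian m (v r)).
    by move=> r0; exact: (closure_extendable_bounded_continuous oO bO (r0 : [set t | 0 < t] r) cL).
  have split_F p q : 0 < p -> 0 < q -> integralN Omega (fun x => v p x * F q x) =
      (-1) ^+ m.+1 * integralN Omega (fun x => v p x * polylaplacian m (v q) x) +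
      integralN Omega (fun x => v p x * v q x).
    move=> p0 q0; have b1 := bounded_continuousM (bv p p0) (bL q q0).
    rewrite -(integralN_Z oO bO)// -(integralN_D oO bO).
    - by apply: eq_integralN => x _; rewrite /F; ring.
    - exact: bounded_continuousZ.
    - by apply: bounded_continuousM; exact: bv.
  rewrite !split_F// (integral_polylaplacianC oO bO (Cv t t0) (Cv s s0))//; try exact: bcv.
  by congr (_ + _); apply: eq_integralN => x _; rewrite mulrC.
have EE t : 0 < t -> energy m Omega (v t) = integralN Omega (fun x => v t x * F t x).
  by move=> t0; apply: energy_dirichlet => //; [exact: Cv|exact: bcv].
have E0 : energy m Omega v0 = energy m Omega (v 0).
  by apply: (eq_energy_in oO) => x Ox; rewrite init.
(* At this time [t] the energy is below its initial value, against monotonicity. *)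
have [t t0] := energy_not_bounded_below oO bO n_gt0 (normr_ge0 M) cv cF dpsi vM' v0_energy.
rewrite ltNge => /negP; apply; rewrite E0 -EE//.
(* Monotonicity is known between positive times only, so time 0 is reached through a small [s <= t],
   at the cost of [eps]. *)
apply/ler_addgt0Pr => eps eps0.
have J1 : `[0, 1]%classic `<=` [set t : R | 0 <= t /\ (t%:E < +oo)%E].
  by move=> s /=; rewrite in_itv/= ltry => /andP[].
have [d d0 Ed] := energy_right_continuous oO bO J1 C1 eps0.
pose s := Order.min (Order.min (d / 2) 1) t.
have s0 : 0 < s by rewrite !lt_min divr_gt0// ltr01.
have st : s <= t by rewrite ge_min lexx orbT.
have s1 : s <= 1 by rewrite !ge_min lexx orbT.
have sd : s < d.
  apply: (@le_lt_trans _ _ (d / 2)); first by rewrite !ge_min lexx.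
  by rewrite ltr_pdivrMr// ltr_pMr// ltr1n.
apply: (le_trans (Ed s (ltW s0) s1 sd)); rewrite lerD2r !EE//.
exact: (energy_nondecreasing oO bO n_gt0 cv cF dpsi vM' sym s0 st).
Qed.
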